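(* Consider a bandit with $n$ arms with mean rewards in $[0,1]$, of which $m$ are best arms (having the maximal mean $\mu^\star$), where pulling an arm yields its mean plus i.i.d. $1$-subgaussian noise. Let $T$ be the time horizon and assume there is $\gamma\in[0,1]$ with $n/m\le T^\gamma$. Consider the algorithm that subsamples $K$ arms uniformly at random without replacement from the $n$ arms and runs Greedy on them, and assume $n$ is large enough for the following subsampling to be possible. Then: (i) if $T^{1-3\gamma}\le\log T$ (in particular if $\gamma\ge 1/3$ and $T\ge2$), choosing $K=2T^{2\gamma}\log T$ gives $R_T\le 14\,T^{\gamma+1/2}\log T+2$; (ii) otherwise, choosing $K=2\sqrt{T^{1+\gamma}\log T}$ gives $R_T\le 14\,T^{(3+\gamma)/4}\sqrt{\log T}+2$.
   Context: The Greedy algorithm on a finite set of arms: at each round it pulls an arm with the highest empirical mean of the rewards observed so far, with the convention $0/0=\infty$ (each arm is pulled once initially). The regret is $R_T=T\mu^\star-\mathbb E\big[\sum_{t=1}^T\mu_{A_t}\big]$, where $\mu_{A_t}$ is the mean of the arm pulled at round $t$ and the expectation includes the randomness of the subsampling. *)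

(* Defs.v *)
From HB Require Import structures.
From mathcomp Require Import all_boot all_order all_algebra.
From mathcomp Require Import all_classical all_reals all_analysis.
Set Implicit Arguments. Unset Strict Implicit. Unset Printing Implicit Defensive.
Import Order.TTheory GRing.Theory Num.Theory.
Local Open Scope classical_set_scope.
Local Open Scope ring_scope.

(* ---------- The Greedy algorithm on a set S of arms ----------
   Reward-table model: r i k is the reward obtained at the (k+1)-th pull of
   arm i.  N i is the number of pulls of arm i so far. *)

Definition emp_mean (R : realType) (n : nat) (r : 'I_n -> nat -> R)
  (N : 'I_n -> nat) (i : 'I_n) : \bar R :=
  if N i == 0%N then +oo%E
  else ((\sum_(k < N i) r i k) / (N i)%:R)%:E.

Definition greedy_maximizers (R : realType) (n : nat) (S : {set 'I_n})
  (r : 'I_n -> nat -> R) (N : 'I_n -> nat) : {set 'I_n} :=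
  [set i in S | [forall j in S, (emp_mean r N j <= emp_mean r N i)%E]].

Definition tie_break (n : nat) (tb : {set 'I_n} -> 'I_n) : Prop :=
  forall A : {set 'I_n}, A != finset.set0 -> tb A \in A.

Fixpoint greedy_counts (R : realType) (n : nat) (tb : {set 'I_n} -> 'I_n)
  (S : {set 'I_n}) (r : 'I_n -> nat -> R) (t : nat) : 'I_n -> nat :=
  match t with
  | 0%N => fun _ => 0%N
  | t'.+1 =>
      let N := greedy_counts tb S r t' in
      let a := tb (greedy_maximizers S r N) in
      fun i => (N i + (i == a))%N
  end.

(* the arm pulled at round t+1 (t = 0, 1, ...) *)
Definition greedy_arm (R : realType) (n : nat) (tb : {set 'I_n} -> 'I_n)
  (S : {set 'I_n}) (r : 'I_n -> nat -> R) (t : nat) : 'I_n :=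
  tb (greedy_maximizers S r (greedy_counts tb S r t)).

(* maximal mean mu^* (means are in [0,1], so 0 is a neutral start) *)
Definition mu_star (R : realType) (n : nat) (mu : 'I_n -> R) : R :=
  \big[Num.max/0]_(i < n) mu i.

Definition num_best (R : realType) (n : nat) (mu : 'I_n -> R) : nat :=
  #|[set i | mu i == mu_star mu]|.

Definition subgaussian1 (d : measure_display) (Om : measurableType d)
  (R : realType) (P : probability Om R) (X : Om -> R) : Prop :=
  forall lam : R, ('E_P[fun w => expR (lam * X w)] <= (expR (lam ^+ 2 / 2))%:E)%E.

(* S is a uniformly random K-subset of the n arms, independent of the noise
   family eps, and the noise variables are mutually independent:
   for every K-subset A, every finite (duplicate-free) list J of indices and
   every family of measurable sets B,
     P(S = A /\ forall j in J, eps j in B j) = C(n,K)^-1 * prod_(j in J) P(eps j in B j). *)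
Definition uniform_subset_indep_noise (d : measure_display)
  (Om : measurableType d) (R : realType) (P : probability Om R) (n K : nat)
  (S : Om -> {set 'I_n}) (eps : 'I_n -> nat -> Om -> R) : Prop :=
  (forall A : {set 'I_n}, measurable (S @^-1` [set A])) /\
  forall (A : {set 'I_n}) (J : seq ('I_n * nat)) (B : 'I_n * nat -> set R),
    #|A| = K -> uniq J -> (forall j, measurable (B j)) ->
    P (S @^-1` [set A] `&`
       \bigcap_(j in [set j | j \in J]) (eps j.1 j.2 @^-1` B j)) =
    (('C(n, K)%:R)^-1 * \prod_(j <- J) fine (P (eps j.1 j.2 @^-1` B j)))%:E.

Definition regret (d : measure_display) (Om : measurableType d)
  (R : realType) (P : probability Om R) (n : nat) (mu : 'I_n -> R)
  (arm : Om -> nat -> 'I_n) (T : nat) : \bar R :=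
  ((T%:R * mu_star mu)%:E - 'E_P[fun w => (\sum_(t < T) mu (arm w t))%R])%E.

Definition subsampled_greedy_arm (d : measure_display) (Om : measurableType d)
  (R : realType) (n : nat) (tb : {set 'I_n} -> 'I_n) (mu : 'I_n -> R)
  (eps : 'I_n -> nat -> Om -> R) (S : Om -> {set 'I_n}) : Om -> nat -> 'I_n :=
  fun w => greedy_arm tb (S w) (fun i k => mu i + eps i k w).

(* Main.v *)
Require Import Defs.
From HB Require Import structures.
From mathcomp Require Import all_boot all_order all_algebra.
From mathcomp Require Import all_classical all_reals all_analysis.
From mathcomp Require Import measurable_realfun ring lra zify.
Import Order.TTheory GRing.Theory Num.Theory.
Set Implicit Arguments. Unset Strict Implicit. Unset Printing Implicit Defensive.

(* Call a best arm good when its empirical mean never falls below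
   [mu_star - delta] up to time [T].  For the walk [Y_k = S_k + k delta] of its
   centered rewards, decomposing over the time of the minimum of [Y] gives
   [1 <= P(good) * \sum_k P(Y_k <= 0)], so subgaussian tails yield
   [P(good) >= 1 - exp(- delta^2 / 2)], of order [delta^2].  The sampled set
   misses all good arms with probability at most
   [exp(- P(good) K m / (2 n))].  Once a good arm is sampled, Greedy pulls an
   arm of gap [Delta > 2 delta] again only while its empirical mean
   overshoots by [Delta - delta], which happens [O(1 / Delta^2)] times on
   average.  Arms of gap at most [D] cost [T D], the others [K (1 + 8 / D)].
   Since [D >= 2 delta], it remains to choose [delta] just large enough for the
   missing probability to be at most [1 / T], and to balance [T D] against
   [8 K / D]. *)

(** The two cases of the theorem are the two positions of the constraint [D >= 2 delta]. A missing
    probability of [1 / T] requires [delta^2 K >= 6 (log T) T^gamma], so the prescribed [K] allows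
    [delta^2 = 3 / T^gamma] in case (i). There [D] of order [T^gamma sqrt (log T / T)] balances
    [T D] against [K / D], and with the constant chosen for it [2 delta <= D] is precisely
    [T^(1 - 3 gamma) <= log T]. In case (ii) the constraint is saturated, [D = 2 delta], and
    balancing [T delta] against [K / delta] gives [K^2] of order [T^(1 + gamma) log T]. Where
    [delta] would exceed 1, the claimed bound already exceeds [T].

    The sample is random and the trajectory of Greedy is a complicated function of it and of the
    noise. Its measurability is never established: the regret is dominated pathwise by indicators of
    events [S = A] intersected with noise events attached to a fixed [A]. Independence is assumed on
    finite rectangles only and reaches events on whole reward sequences through pi-systems. *)

Local Open Scope ring_scope.

(** * Uniform subsets of the arms *)

(** Removing one element from a set of [N <= n] elements multiplies the number of its [K]-subsets by
    [1 - K / N <= 1 - K / n]. *)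
Lemma bin_sub_le (R : realType) (n K g : nat) : (g <= n)%N -> (0 < n)%N ->
  'C(n - g, K)%:R <= 'C(n, K)%:R * expR (- (K%:R / n%:R)) ^+ g :> R.
Proof.
move=> gn n0; elim: g gn => [|g IH] gn; first by rewrite subn0 expr0 mulr1.
have e1 : 1 - K%:R / n%:R <= expR (- (K%:R / n%:R)) :> R by exact: expR_ge1Dx.
have e0 := @expR_ge0 R (- (K%:R / n%:R)).
have h := IH (ltnW gn).
rewrite exprSr mulrA; apply: le_trans (ler_wpM2r e0 h).
set N := (n - g)%N in h *.
have N0 : (0 < N)%N by rewrite subn_gt0.
have -> : (n - g.+1 = N.-1)%N by rewrite subnS.
have [KN|NK] := leqP K N; last first.
  by rewrite bin_small ?mulr_ge0// (leq_ltn_trans (leq_pred _)).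
apply: (@le_trans _ _ ('C(N, K)%:R * (1 - K%:R / n%:R))); last first.
  by rewrite ler_wpM2l.
apply: (@le_trans _ _ ('C(N, K)%:R * (1 - K%:R / N%:R))); last first.
  rewrite ler_wpM2l// lerD2l lerN2 ler_wpM2l// lef_pV2 ?posrE ?ltr0n//.
  by rewrite ler_nat leq_subr.
have NR : N%:R != 0 :> R by rewrite pnatr_eq0 -lt0n.
rewrite -[leLHS](mulKf NR) -natrM mul_bin_down natrM (natrB _ KN).
move: ('C(N, K)%:R : R) (K%:R : R) (N%:R : R) NR => c k x x0.
by rewrite le_eqVlt; apply/orP; left; apply/eqP; field; exact: x0.
Qed.

(* Induction on [B]: a point [i] of [B] contributes
   [(1 - p) ^+ (i \in A) = (1 - p) + p * (i \notin A)], and in the second term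
   [i] moves from [B] to [G]. *)
Lemma sum_subsets_avoiding (R : realType) (n K : nat) (p : R)
    (B G : {set 'I_n}) :
  (0 < n)%N -> 0 <= p <= 1 -> [disjoint B & G] ->
  \sum_(A : {set 'I_n} | (#|A| == K) && [disjoint A & G])
    (1 - p) ^+ #|A :&: B| <=
  'C(n, K)%:R * expR (- (K%:R / n%:R)) ^+ #|G| *
    (1 - p + p * expR (- (K%:R / n%:R))) ^+ #|B|.
Proof.
move=> n0 /andP[p0 p1]; set e := expR _.
have e0 : 0 <= e by exact: expR_ge0.
have [m] := ubnP #|B|; elim: m => // m IH in B G *.
have [->|[i iB]] := set_0Vmem B.
  move=> _ _; rewrite cards0 expr0 mulr1.
  under eq_bigr do rewrite finset.setI0 cards0 expr0.
  rewrite sumr_const -(@cardsE _ (fun A : {set 'I_n} => _)).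
  have -> : [set A : {set 'I_n} | (#|A| == K) && [disjoint A & G]] =
      [set A : {set 'I_n} | (A \subset ~: G) && (#|A| == K)]%SET.
    by apply/setP => A; rewrite !inE andbC finset.disjoints_subset.
  rewrite cards_draws cardsCs finset.setCK card_ord.
  by apply: bin_sub_le => //; rewrite -[leqRHS]card_ord max_card.
move=> Bm dBG; set B' := B :\ i.
have iG : i \notin G by move: dBG => /disjointFr ->.
have cB : #|B| = #|B'|.+1 by rewrite (cardsD1 i B) iB.
have B'm : (#|B'| < m)%N by rewrite -ltnS -cB.
have dB' : [disjoint B' & G] by apply: disjointWl dBG; exact: subD1set.
have dU (A : {set 'I_n}) :
    [disjoint A & i |: G] = [disjoint A & G] && (i \notin A).
  rewrite ![[disjoint A & _]]disjoint_sym !finset.disjoints_subset.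
  by rewrite finset.subUset finset.sub1set inE andbC.
have dB'i : [disjoint B' & i |: G] by rewrite dU dB' !inE eqxx.
have h1 := IH _ _ B'm dB'; have h2 := IH _ _ B'm dB'i.
rewrite (_ : \sum_(A | _) _ =
  (1 - p) * (\sum_(A : {set 'I_n} | (#|A| == K) && [disjoint A & G])
    (1 - p) ^+ #|A :&: B'|) +
  p * (\sum_(A : {set 'I_n} | (#|A| == K) && [disjoint A & (i |: G)])
    (1 - p) ^+ #|A :&: B'|)); last first.
  rewrite [X in _ + p * X](_ : _ =
    \sum_(A : {set 'I_n} | (#|A| == K) && [disjoint A & G])
      (i \notin A)%:R * (1 - p) ^+ #|A :&: B'|); last first.
    rewrite [RHS](bigID (fun A : {set 'I_n} => i \notin A))/=.
    rewrite [X in _ = _ + X]big1 ?addr0; last first.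
      by move=> A /andP[_ /negPn ->]; rewrite mul0r.
    apply: eq_big => [A|A /andP[_]].
      by rewrite dU andbA.
    by rewrite dU => /andP[_ ->]; rewrite mul1r.
  rewrite !mulr_sumr -big_split/=; apply: eq_bigr => A _.
  have -> : #|A :&: B| = ((i \in A) + #|A :&: B'|)%N.
    rewrite (cardsD1 i) !inE iB andbT; congr (_ + #|pred_of_set _|)%N.
    by rewrite /B' finset.setIDA.
  by rewrite exprD; case: (i \in A) => /=; ring.
rewrite cardsU1 iG add1n exprS in h2.
rewrite cB exprS.
set g := _ ^+ #|G| in h1 h2 *; set b := _ ^+ #|B'| in h1 h2 *.
have h1' : (1 - p) * (\sum_(A : {set 'I_n} | (#|A| == K) && [disjoint A & G])
    (1 - p) ^+ #|A :&: B'|) <= (1 - p) * ('C(n, K)%:R * g * b).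
  by apply: ler_wpM2l => //; rewrite subr_ge0.
have h2' := ler_wpM2l p0 h2.
apply: le_trans (lerD h1' h2') _.
by rewrite le_eqVlt; apply/orP; left; apply/eqP; ring.
Qed.

(** If each element of [B] is marked independently with probability [p], the left side is the
    probability that a uniform [K]-subset contains no marked element. It is used with the best arms
    as [B], where being good plays the role of the mark. *)
Lemma expected_power_intersection (R : realType) (n K : nat) (p : R)
    (B : {set 'I_n}) :
  (0 < n)%N -> (K <= n)%N -> 0 <= p <= 1 ->
  \sum_(A : {set 'I_n} | #|A| == K) ('C(n, K)%:R)^-1 * (1 - p) ^+ #|A :&: B| <=
  expR (- (p * (K%:R * #|B|%:R / n%:R) / 2)).
Proof.
move=> n0 Kn p01.
have dB : [disjoint B & finset.set0] by rewrite -finset.setI_eq0 finset.setI0.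
have := sum_subsets_avoiding K n0 p01 dB.
rewrite cards0 expr0 mulr1.
under eq_bigl do rewrite -finset.setI_eq0 finset.setI0 eqxx andbT.
have C0 : 0 < 'C(n, K)%:R :> R by rewrite ltr0n bin_gt0.
move=> h; rewrite -mulr_sumr ler_pdivrMl//; apply: (le_trans h).
rewrite ler_pM2l//; case/andP: p01 => p0 p1.
set y := K%:R / n%:R.
have y0 : 0 <= y by rewrite divr_ge0.
have y1 : y <= 1 by rewrite ler_pdivrMr ?ltr0n// mul1r ler_nat.
(* On [[0, 1]] one has [exp (- y) <= 1 / (1 + y) <= 1 - y / 2]; the 2 in the exponent of the lemma
   comes from here. *)
have e1 : expR (- y) <= 1 - y / 2.
  have e2 : 1 + y <= expR y by exact: expR_ge1Dx.
  have e3 : expR y * expR (- y) = 1 by rewrite expRN mulfV// gt_eqF// expR_gt0.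
  have e0 := @expR_gt0 R (- y).
  have h1 : (1 + y) * expR (- y) <= 1.
    by rewrite -[leRHS]e3; apply: ler_wpM2r => //; exact: ltW.
  have h2 : 1 <= (1 + y) * (1 - y / 2) by nra.
  have y' : 0 < 1 + y by lra.
  by rewrite -(ler_pM2l y'); exact: le_trans h1 h2.
have b1 : 1 - p + p * expR (- y) <= expR (- (p * y / 2)).
  apply: le_trans (expR_ge1Dx _).
  by have := ler_wpM2l p0 e1; lra.
rewrite (_ : - (p * _ / 2) = #|B|%:R * - (p * y / 2)); last by rewrite /y; ring.
rewrite expRM_natl; apply: lerXn2r b1; rewrite ?nnegrE ?expR_ge0//.
by rewrite addr_ge0 ?mulr_ge0 ?expR_ge0// subr_ge0.
Qed.

(** * Trajectories of Greedy *)

Lemma greedy_arm_max (R : realType) (n : nat) (tb : {set 'I_n} -> 'I_n)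
    (S : {set 'I_n}) (r : 'I_n -> nat -> R) (t : nat) (i0 : 'I_n) :
  tie_break tb -> i0 \in S ->
  greedy_arm tb S r t \in S /\ forall j, j \in S ->
    (emp_mean r (greedy_counts tb S r t) j <=
     emp_mean r (greedy_counts tb S r t) (greedy_arm tb S r t))%E.
Proof.
move=> htb i0S; rewrite /greedy_arm.
set N := greedy_counts _ _ _ _; set M := greedy_maximizers _ _ _.
have M0 : M != finset.set0.
  have [i iS imax] := @arg_maxP _ _ _ i0 (fun i => i \in S) (emp_mean r N) i0S.
  apply/finset.set0Pn; exists i; rewrite inE; apply/andP; split; first exact: iS.
  by apply/forall_inP => j jS; exact: imax.
have := htb _ M0; move: (tb M) => a; rewrite inE => /andP[aS /forall_inP h].
by split.
Qed.

Lemma sum_greedy_counts (R : realType) (n : nat) (tb : {set 'I_n} -> 'I_n)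
    (S : {set 'I_n}) (r : 'I_n -> nat -> R) (t : nat) (f : 'I_n -> R) :
  \sum_(s < t) f (greedy_arm tb S r s) =
  \sum_i f i * (greedy_counts tb S r t i)%:R.
Proof.
elim: t => [|t IH].
  by rewrite big_ord0 big1// => i _; rewrite mulr0.
rewrite big_ord_recr/= IH -/(greedy_arm tb S r t).
under [RHS]eq_bigr do rewrite natrD mulrDr.
rewrite big_split/=; congr (_ + _).
rewrite (bigD1 (greedy_arm tb S r t))//= eqxx mulr1 big1 ?addr0// => i /negbTE ->.
by rewrite mulr0.
Qed.

Lemma greedy_counts_le (R : realType) (n : nat) (tb : {set 'I_n} -> 'I_n)
    (S : {set 'I_n}) (r : 'I_n -> nat -> R) (t : nat) (i : 'I_n) :
  (greedy_counts tb S r t i <= t)%N.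
Proof. by elim: t => //= t IH; rewrite -addn1 leq_add// leq_b1. Qed.

(* For [u < N_i], the count [u] was once the number of pulls of [i] at a round
   where [i] was pulled again, so its empirical mean beat that of [i0]. *)
Lemma greedy_pull_above (R : realType) (n : nat) (tb : {set 'I_n} -> 'I_n)
    (S : {set 'I_n}) (r : 'I_n -> nat -> R) (T : nat) (i0 : 'I_n) (b : R) :
  tie_break tb -> i0 \in S ->
  (forall u, (u < T)%N -> u%:R * b <= \sum_(k < u) r i0 k) ->
  forall t, (t <= T)%N -> forall i,
  (0 < greedy_counts tb S r t i)%N -> i \in S /\
  forall u, (0 < u < greedy_counts tb S r t i)%N ->
    u%:R * b <= \sum_(k < u) r i k.
Proof.
move=> htb i0S hb; elim=> [//|t IH] tT i.
have [aS amax] := @greedy_arm_max R n tb S r t i0 htb i0S.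
move: IH; rewrite [greedy_counts _ _ _ t.+1]/= -/(greedy_arm tb S r t).
set N := greedy_counts tb S r t; set a := greedy_arm tb S r t => IH.
have {}IH := IH (ltnW tT).
have [ia|ia] := eqVneq i a; last by rewrite addn0; exact: IH.
rewrite addn1 ia => _; split => // u /andP[u0]; rewrite ltnS leq_eqVlt.
case/predU1P => [uN|uN]; last first.
  have [|_] := IH a; first by rewrite (leq_ltn_trans _ uN).
  by apply; rewrite u0.
have := amax _ i0S; rewrite -/N /emp_mean -/a -uN (negbTE (lt0n_neq0 u0)).
(* Arm [i0] has been pulled before: otherwise its empirical mean [+oo] would exceed the finite one
   of [a]. *)
case: ifP => [|/negbT Ni0]; first by rewrite leye_eq.
have Ni0T : (N i0 < T)%N by exact: leq_ltn_trans (greedy_counts_le _ _ _ _ _) tT.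
rewrite lee_fin => h; have := hb _ Ni0T.
rewrite -ler_pdivlMl ?ltr0n ?lt0n// mulrC => /le_trans/(_ h).
by rewrite ler_pdivlMr ?ltr0n// mulrC.
Qed.

(** By [greedy_pull_above] every [u] with [1 <= u < N_i] is an overshoot, so [N_i] is at most 1 plus
    the number of overshoots. The 1 is the initial pull, made on an infinite empirical mean. *)
Lemma greedy_regret_pathwise (R : realType) (n : nat)
    (tb : {set 'I_n} -> 'I_n) (mu : 'I_n -> R) (ms : R) (S : {set 'I_n})
    (e : 'I_n -> nat -> R) (T : nat) (i0 : 'I_n) (dl D : R) :
  tie_break tb -> i0 \in S -> mu i0 = ms -> (forall i, mu i <= ms) ->
  0 <= D ->
  (forall u, (u < T)%N -> - (u%:R * dl) <= \sum_(k < u) e i0 k) ->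
  T%:R * ms <=
  \sum_(t < T) mu (greedy_arm tb S (fun i k => mu i + e i k) t) + (T%:R * D +
  \sum_(i in S | D < ms - mu i) (ms - mu i) *
    (1 + \sum_(1 <= u < T)
       ((u%:R * (ms - mu i - dl) <= \sum_(k < u) e i k)%R : bool)%:R)).
Proof.
move=> htb i0S mi0 mule D0 hi0; set r := fun i k => mu i + e i k.
have rsum i u : \sum_(k < u) r i k = u%:R * mu i + \sum_(k < u) e i k.
  by rewrite big_split/= sumr_const card_ord mulr_natl.
have hb u : (u < T)%N -> u%:R * (ms - dl) <= \sum_(k < u) r i0 k.
  by move=> /hi0; rewrite rsum mi0 mulrBr lerD2l.
have above := @greedy_pull_above R n tb S r T i0 _ htb i0S hb T (leqnn T).
pose N := greedy_counts tb S r T.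
have tot : \sum_i (N i)%:R = T%:R :> R.
  have := @sum_greedy_counts R n tb S r T (fun=> 1).
  rewrite sumr_const card_ord => ->.
  by apply: eq_bigr => i _; rewrite mul1r.
rewrite sum_greedy_counts -/N -tot !mulr_suml.
rewrite [X in _ + (_ + X)]big_mkcond/= -!big_split/=.
apply: ler_sum => i _.
have N0 : 0 <= (N i)%:R :> R by [].
have [Ni0|Nipos] := posnP (N i).
  rewrite Ni0 mul0r mulr0 mul0r !add0r; case: ifP => // /andP[_ Di].
  apply: mulr_ge0; first by rewrite subr_ge0.
  by rewrite addr_ge0// sumr_ge0.
have [iS hi] := above i Nipos; rewrite iS /=.
case: ifPn => [Di|]; last first.
  by rewrite -leNgt => Di; have := ler_wpM2l N0 Di; nra.
set s := \sum_(1 <= u < T) _.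
suff : (N i)%:R <= 1 + s.
  have Di0 : 0 <= ms - mu i by rewrite subr_ge0.
  by move=> /(ler_wpM2l Di0); have := mulr_ge0 N0 D0; lra.
have NT : (N i <= T)%N by exact: greedy_counts_le.
rewrite /s (@big_cat_nat _ _ _ (N i))//=.
set s1 := (X in 1 + (X + _)); set s2 := (X in 1 + (_ + X)).
have s20 : 0 <= s2 by exact: sumr_ge0.
suff -> : s1 = (N i)%:R - 1 by lra.
rewrite /s1 (eq_big_nat _ _ (F2 := fun=> 1)) => [|u /andP[u0 uN]].
  by rewrite sumr_const_nat natrB.
have := hi u; rewrite u0 uN rsum => /(_ isT) h.
have -> // : u%:R * (ms - mu i - dl) <= \sum_(k < u) e i k.
by move: h; rewrite !mulrBr; lra.
Qed.

Local Open Scope classical_set_scope.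
Local Open Scope ring_scope.

(** * Independence and sequences of random variables *)

Lemma measurable_preimage_generated (d : measure_display)
    (Om : measurableType d) (T : Type) (G : set (set T)) (f : Om -> T) :
  (forall A, G A -> measurable (f @^-1` A)) ->
  forall D, <<s G >> D -> measurable (f @^-1` D).
Proof.
move=> mG.
suff : <<s G >> `<=` [set D | measurable (f @^-1` D)] by [].
apply: smallest_sub => //; split=> /=.
- by rewrite preimage_set0.
- by move=> A mA; rewrite setTD preimage_setC; exact: measurableC.
- by move=> F mF; rewrite preimage_bigcup; exact: bigcupT_measurable.
Qed.

(** Uniqueness of finite measures on a pi-system, for the law of [Phi] restricted to [C] and [c]
    times the law of [Psi]. The type [T] is bare; the sigma-algebra generated by [G] is put on it
    inside the proof, with [Phi point] as the required point. *)
Lemma pi_system_law_ext (d : measure_display) (Om : measurableType d)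
    (R : realType) (P : probability Om R) (T : Type) (G : set (set T))
    (Phi Psi : Om -> T) (C : set Om) (c : R) :
  setI_closed G -> G setT -> measurable C -> 0 <= c ->
  (forall A, G A -> measurable (Phi @^-1` A)) ->
  (forall A, G A -> measurable (Psi @^-1` A)) ->
  (forall A, G A -> P (C `&` Phi @^-1` A) = (c%:E * P (Psi @^-1` A))%E) ->
  forall D, <<s G >> D -> P (C `&` Phi @^-1` D) = (c%:E * P (Psi @^-1` D))%E.
Proof.
move=> IG GsetT mC c0 mPhi mPsi PE D GD.
pose T' : pointedType := HB.pack T (gen_eqMixin T) (gen_choiceMixin T)
  (isPointed.Build T (Phi point)).
pose GT : measurableType _ := g_sigma_algebraType (G : set (set T')).
have mf (f : Om -> T) : (forall A, G A -> measurable (f @^-1` A)) ->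
    measurable_fun setT (f : Om -> GT).
  move=> mfG; apply: (@measurability _ _ Om (GT) setT f G) => //.
  by move=> _ [A GA <-]; rewrite setTI; exact: mfG.
pose m1 : {measure set (GT) -> \bar R} :=
  pushforward (mrestr P mC) (Phi : Om -> GT).
pose m2 : {measure set (GT) -> \bar R} :=
  mscale (NngNum c0) (pushforward P (Psi : Om -> GT)).
have E : m1 (mf _ mPhi) D = m2 (mf _ mPsi) D.
  apply: (@measure_unique _ R (GT) G (fun=> setT) _ _ _ _
    (m1 (mf _ mPhi)) (m2 (mf _ mPsi))) => //.
  - by rewrite bigcup_const.
  - move=> A GA.
    change (P (Phi @^-1` A `&` C) = c%:E * P (Psi @^-1` A))%E.
    by rewrite setIC PE.
  - move=> k; change (P (Phi @^-1` setT `&` C) < +oo)%E.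
    by rewrite preimage_setT setTI (le_lt_trans (probability_le1 _ _)) ?ltry.
by rewrite setIC; exact: E.
Qed.

(** Finite-dimensional rectangles: a pi-system determining the law of a reward sequence, on which
    independence can be read off as a product. *)
Definition cylinders (R : realType) : set (set (nat -> R)) :=
  [set A | exists N (B : nat -> set R), (forall k, measurable (B k)) /\
    A = [set x | forall k, (k < N)%N -> B k (x k)]].

Lemma cylindersI (R : realType) : setI_closed (@cylinders R).
Proof.
move=> _ _ [N1 [B1 [mB1 ->]]] [N2 [B2 [mB2 ->]]].
exists (maxn N1 N2), (fun k => [set r | (k < N1)%N -> B1 k r] `&`
                              [set r | (k < N2)%N -> B2 k r]); split.
  have mimp (b : bool) (B : set R) : measurable B ->
      measurable [set r | b -> B r].
    case: b => mB.
      by rewrite (_ : mkset _ = B)//; apply/seteqP; split => r /=; auto.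
    by rewrite (_ : mkset _ = setT)//; apply/seteqP; split => r.
  by move=> k; apply: measurableI; exact: mimp.
apply/seteqP; split => x /=.
  by move=> [h1 h2] k _; split; auto.
move=> h; split=> k hk.
  by have /h[/(_ hk)] : (k < maxn N1 N2)%N by rewrite leq_max hk.
by have /h[_ /(_ hk)] : (k < maxn N1 N2)%N by rewrite leq_max hk orbT.
Qed.

Lemma cylindersT (R : realType) : @cylinders R setT.
Proof.
exists 0%N, (fun=> setT); split => //.
by apply/seteqP; split.
Qed.

(** With [C = setT] and [c = 1] this is mutual independence of the family. With [C] the event that
    the sample is a given set, it also says that the family is independent of that event. The empty
    list [s] forces [c = P C]. *)
Definition product_rule (d : measure_display) (Om : measurableType d)
    (R : realType) (P : probability Om R) (I : eqType) (X : I -> Om -> R)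
    (C : set Om) (c : R) :=
  forall (s : seq I) (B : I -> set R), uniq s ->
    (forall j, measurable (B j)) ->
    P (C `&` [set w | forall j, j \in s -> B j (X j w)]) =
    (c * \prod_(j <- s) fine (P (X j @^-1` B j)))%:E.

Lemma measurable_rect (d : measure_display) (Om : measurableType d)
    (R : realType) (I : eqType) (X : I -> Om -> R)
    (s : seq I) (B : I -> set R) :
  (forall j, measurable_fun setT (X j)) -> (forall j, measurable (B j)) ->
  measurable [set w | forall j, j \in s -> B j (X j w)].
Proof.
move=> mX mB; elim: s => [|j s IH].
  rewrite (_ : mkset _ = setT)//.
  by apply/seteqP; split.
rewrite (_ : mkset _ = X j @^-1` B j `&`
    [set w | forall j, j \in s -> B j (X j w)]).
  apply: measurableI => //.
  by rewrite -[X in measurable X]setTI; exact: mX.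
apply/seteqP; split => w /=.
  move=> h; split; first by apply: h; rewrite mem_head.
  by move=> k ks; apply: h; rewrite inE ks orbT.
by move=> [h1 h2] k; rewrite inE => /predU1P[->|]//; exact: h2.
Qed.

Lemma measurable_cylinder_preimage (d : measure_display)
    (Om : measurableType d) (R : realType) (X : nat -> Om -> R) D :
  (forall j, measurable_fun setT (X j)) -> <<s @cylinders R >> D ->
  measurable ((fun w k => X k w) @^-1` D).
Proof.
move=> mX; apply: measurable_preimage_generated => _ [N [B [mB ->]]].
rewrite (_ : _ @^-1` _ = [set w | forall j, j \in iota 0 N -> B j (X j w)]).
  exact: measurable_rect.
by apply/seteqP; split => w h k; [rewrite mem_iota/=; exact: h|
  move=> kN; apply: h; rewrite mem_iota].
Qed.

(** Induction on [L], promoting one block at a time from cylinders to the generated sigma-algebra.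
    For a cylinder, the constraints on block [i] are moved to the list [s] and the induction
    hypothesis applies; this is why the statement carries both [s] and [L]. *)
Lemma independent_blocks (d : measure_display) (Om : measurableType d)
    (R : realType) (P : probability Om R) (A : eqType) (X : A * nat -> Om -> R)
    (C : set Om) (c : R) :
  (forall j, measurable_fun setT (X j)) -> measurable C -> 0 <= c ->
  product_rule P X setT 1 -> product_rule P X C c ->
  forall (L : seq A) (D : A -> set (nat -> R)) (s : seq (A * nat))
    (B : A * nat -> set R),
  uniq L -> uniq s -> (forall j, j \in s -> j.1 \notin L) ->
  (forall i, <<s @cylinders R >> (D i)) -> (forall j, measurable (B j)) ->
  P (C `&` [set w | forall j, j \in s -> B j (X j w)] `&`
     [set w | forall i, i \in L -> D i (fun k => X (i, k) w)]) =
  (c * \prod_(j <- s) fine (P (X j @^-1` B j)) *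
   \prod_(i <- L) fine (P ((fun w k => X (i, k) w) @^-1` D i)))%:E.
Proof.
move=> mX mC c0 P1 PC L D; elim: L => [|i L IH] s B uL us sL sD mB.
  rewrite big_nil mulr1 -PC// (_ : [set w | forall i, i \in [::] ->
      D i (fun k => X (i, k) w)] = setT) ?setIT//.
  by apply/seteqP; split.
have mblock (L' : seq A) :
    measurable [set w | forall i, i \in L' -> D i (fun k => X (i, k) w)].
  elim: L' => [|a L' IHL].
    rewrite (_ : mkset _ = setT)//.
    by apply/seteqP; split.
  rewrite (_ : mkset _ = (fun w k => X (a, k) w) @^-1` D a `&`
      [set w | forall i, i \in L' -> D i (fun k => X (i, k) w)]).
    apply: measurableI => //.
    exact: (@measurable_cylinder_preimage _ _ _ (fun k => X (a, k))).
  apply/seteqP; split => w /=.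
    move=> h; split; first by apply: h; rewrite mem_head.
    by move=> k ks; apply: h; rewrite inE ks orbT.
  by move=> [h1 h2] k; rewrite inE => /predU1P[->|]//; exact: h2.
move: uL => /= /andP[iL uL].
have sL' j : j \in s -> j.1 \notin L.
  by move=> /sL; rewrite inE negb_or => /andP[].
have si j : j \in s -> j.1 != i.
  by move=> /sL; rewrite inE negb_or => /andP[].
pose C' := C `&` [set w | forall j, j \in s -> B j (X j w)] `&`
     [set w | forall i, i \in L -> D i (fun k => X (i, k) w)].
pose c' := c * \prod_(j <- s) fine (P (X j @^-1` B j)) *
   \prod_(i <- L) fine (P ((fun w k => X (i, k) w) @^-1` D i)).
have mC' : measurable C'.
  by apply: measurableI => //; apply: measurableI => //; exact: measurable_rect.
have c'0 : 0 <= c'.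
  by rewrite !mulr_ge0// prodr_ge0// => ? _; rewrite fine_ge0.
pose Phi w : nat -> R := fun k => X (i, k) w.
have mPhi D' : <<s @cylinders R >> D' -> measurable (Phi @^-1` D').
  exact: (@measurable_cylinder_preimage _ _ _ (fun k => X (i, k))).
rewrite (_ : _ `&` _ `&` _ = C' `&` Phi @^-1` D i); last first.
  apply/seteqP; split => w /=.
    move=> [h1 h2]; split; last by apply: h2; rewrite mem_head.
    by split => // k kL; apply: h2; rewrite inE kL orbT.
  move=> [[h1 h2] h3]; split => // k.
  by rewrite inE => /predU1P[->|]//; exact: h2.
rewrite big_cons mulrCA -/c' mulrC EFinM.
rewrite (@pi_system_law_ext _ _ _ P _ (@cylinders R) Phi Phi C' c')//.
- by rewrite fineK ?fin_num_measure//; exact: mPhi.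
- exact: cylindersI.
- exact: cylindersT.
- by move=> ? ?; apply: mPhi; exact: sub_sigma_algebra.
- by move=> ? ?; apply: mPhi; exact: sub_sigma_algebra.
move=> _ [N [Bg [mBg ->]]].
pose s' := [seq (i, k) | k <- iota 0 N].
(* Overriding [B] on block [i] is harmless, since [s] has no index in that block. *)
pose B' j := if j.1 == i then Bg j.2 else B j.
have mB' j : measurable (B' j) by rewrite /B'; case: ifP.
have us' : uniq s'.
  by rewrite map_inj_uniq ?iota_uniq// => ? ? [->].
have uss' : uniq (s ++ s').
  rewrite cat_uniq us us' andbT /=; apply/hasPn => _ /mapP[k _ ->].
  by apply/negP => /si; rewrite eqxx.
have E1 : Phi @^-1` [set x | forall k, (k < N)%N -> Bg k (x k)] =
    [set w | forall j, j \in s' -> B' j (X j w)].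
  apply/seteqP; split => w /= h.
    move=> _ /mapP[k kN ->]; rewrite /B' /= eqxx; apply: h.
    by move: kN; rewrite mem_iota.
  move=> k kN; have := h (i, k); rewrite /B' /= eqxx; apply.
  by apply/mapP; exists k => //; rewrite mem_iota.
have -> : P (Phi @^-1` [set x | forall k, (k < N)%N -> Bg k (x k)]) =
    (\prod_(j <- s') fine (P (X j @^-1` B' j)))%:E.
  by rewrite E1 -[LHS]/(P _) -[X in P X]setTI P1// mul1r.
rewrite E1 (_ : C' `&` _ = C `&`
  [set w | forall j, j \in s ++ s' -> B' j (X j w)] `&`
  [set w | forall i, i \in L -> D i (fun k => X (i, k) w)]).
  rewrite IH// => [|j].
    rewrite big_cat/= -EFinM /c'; congr EFin.
    rewrite (eq_big_seq (fun j => fine (P (X j @^-1` B j)))) => [|j /si ji].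
      by rewrite mulrA mulrAC.
    by rewrite /B' (negbTE ji).
  rewrite mem_cat => /orP[/sL'//|/mapP[k _ ->]//].
apply/seteqP; split => w /=.
  move=> [[[hC hs] hL] hs']; split => //; split => // j.
  rewrite mem_cat => /orP[js|]; last exact: hs'.
  by rewrite /B' (negbTE (si _ js)); exact: hs.
move=> [[hC hs] hL]; split; last first.
  by move=> j js; apply: hs; rewrite mem_cat js orbT.
split => //; split => // j js.
by have := hs j; rewrite /B' (negbTE (si _ js)) mem_cat js; exact.
Qed.

(** Rectangles only, for direct use of [product_rule]; the past up to time [k] is the sigma-algebra
    [<<s past X k >>]. *)
Definition past (R : realType) (Om : Type) (X : nat -> Om -> R) (k : nat) :
    set (set Om) :=
  [set F | exists B : nat -> set R, (forall j, measurable (B j)) /\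
    F = [set w | forall j, (j < k)%N -> B j (X j w)]].

Lemma past_measurable (d : measure_display) (Om : measurableType d)
    (R : realType) (X : nat -> Om -> R) (k : nat) F :
  (forall j, measurable_fun setT (X j)) -> past X k F -> measurable F.
Proof.
move=> mX [B [mB ->]].
rewrite (_ : mkset _ = [set w | forall j, j \in iota 0 k -> B j (X j w)]).
  exact: measurable_rect.
by apply/seteqP; split => w h j; have := h j; rewrite mem_iota.
Qed.

(** Two pi-system arguments: first in the future event with a rectangle of the past fixed, then in
    the past event. Identical distribution removes the shift by [k], so the future factor is that of
    the walk restarted at time 0. *)
Lemma past_future_indep (d : measure_display) (Om : measurableType d)
    (R : realType) (P : probability Om R) (X : nat -> Om -> R) (k : nat) :
  (forall j, measurable_fun setT (X j)) ->
  (forall i j B, measurable B -> P (X i @^-1` B) = P (X j @^-1` B)) ->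
  product_rule P X setT 1 ->
  forall F D, <<s past X k >> F -> <<s @cylinders R >> D ->
  P (F `&` (fun w m => X (k + m)%N w) @^-1` D) =
  (P F * P ((fun w m => X m w) @^-1` D))%E.
Proof.
move=> mX idX PX F D sF sD.
have mfut q : measurable ((fun w m => X (q + m)%N w) @^-1` D).
  by apply: (@measurable_cylinder_preimage _ _ _ (fun m => X (q + m)%N)).
have fut F' D' : past X k F' -> <<s @cylinders R >> D' ->
    P (F' `&` (fun w m => X (k + m)%N w) @^-1` D') =
    ((fine (P F'))%:E * P ((fun w m => X m w) @^-1` D'))%E.
  move=> pF' sD'; have mF' := past_measurable mX pF'.
  move: D' sD'; apply: (@pi_system_law_ext _ _ _ P _ (@cylinders R)) => //.
  - exact: cylindersI.
  - exact: cylindersT.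
  - by rewrite fine_ge0.
  - move=> A cA; apply: (@measurable_cylinder_preimage _ _ _
      (fun m => X (k + m)%N)) => //; exact: sub_sigma_algebra.
  - move=> A cA; apply: (@measurable_cylinder_preimage _ _ _ X) => //.
    exact: sub_sigma_algebra.
  move=> _ [N [B [mB ->]]]; case: pF' mF' => B' [mB' ->] mF'.
  pose B2 j := if (j < k)%N then B' j else B (j - k)%N.
  have rect (m : nat) (B0 : nat -> set R) : (forall j, measurable (B0 j)) ->
      P [set w | forall j, (j < m)%N -> B0 j (X j w)] =
      (\prod_(0 <= j < m) fine (P (X j @^-1` B0 j)))%:E.
    move=> mB0; rewrite -[RHS]mul1e -EFinM /index_iota subn0 -(PX (iota 0 m))//.
      rewrite setTI; congr (P _).
      by apply/seteqP; split => w h j; have := h j; rewrite mem_iota.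
    exact: iota_uniq.
  transitivity (P [set w | forall j, (j < k + N)%N -> B2 j (X j w)]).
    congr (P _); apply/seteqP; split => w /=.
      move=> [h1 h2] j jkN; rewrite /B2; case: ltnP => jk; first exact: h1.
      have := h2 (j - k)%N; rewrite subnKC//; apply.
      by rewrite ltn_subLR.
    move=> h; split => j jk.
      by have := h j; rewrite /B2 jk; apply; exact: ltn_addr.
    have := h (k + j)%N; rewrite /B2 ltn_add2l addKn.
    by rewrite (ltnNge (k + j)%N k) leq_addr/=; apply.
  rewrite [X in X = _]rect; last by move=> j; rewrite /B2; case: ifP.
  rewrite [X in (fine X)%:E]rect//.
  rewrite (_ : (fun w m => X m w) @^-1` _ =
    [set w | forall j, (j < N)%N -> B j (X j w)])//.
  rewrite [X in (_ * X)%E]rect// -EFinM; congr EFin.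
  rewrite (@big_cat_nat _ _ _ k)//= ?leq_addr//; congr (_ * _).
    by apply: eq_big_nat => j /andP[_ jk]; rewrite /B2 jk.
  rewrite -{1}[k]add0n big_addn addKn; apply: eq_bigr => j _.
  by rewrite /B2 ltnNge leq_addl/= addnK (idX (j + k)%N j).
(* Second extension: the future event is now the fixed set, and both maps are the identity of
   [Om]. *)
pose Y := (fun w m => X (k + m)%N w) @^-1` D.
pose q := P ((fun w m => X m w) @^-1` D).
have mq : measurable ((fun w m => X m w) @^-1` D).
  exact: (@measurable_cylinder_preimage _ _ _ X).
rewrite setIC muleC -/q -[q]fineK ?fin_num_measure//.
move: F sF; apply: (@pi_system_law_ext _ _ _ P _ (past X k) id id) => //.
- move=> _ _ [B1 [mB1 ->]] [B2 [mB2 ->]].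
  exists (fun j => B1 j `&` B2 j); split.
    by move=> j; exact: measurableI.
  apply/seteqP; split => w /=; first by move=> [h1 h2] j jk; split; auto.
  by move=> h; split => j /h[].
- by exists (fun=> setT); split => //; apply/seteqP; split.
- by rewrite fine_ge0// measure_ge0.
- by move=> A; exact: past_measurable.
- by move=> A; exact: past_measurable.
move=> A pA; rewrite setIC muleC.
have mA := past_measurable mX pA.
by rewrite (fut _ _ pA)// !fineK// ?fin_num_measure.
Qed.

(** * Subgaussian random walks *)

Lemma expectation_mul_indep (d : measure_display) (Om : measurableType d)
    (R : realType) (P : probability Om R) (U V : Om -> R) :
  measurable_fun setT U -> measurable_fun setT V ->
  (forall w, 0 <= U w) -> (forall w, 0 <= V w) ->
  (forall A B, measurable A -> measurable B ->
    P (U @^-1` A `&` V @^-1` B) = (P (U @^-1` A) * P (V @^-1` B))%E) ->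
  (\int[P]_w (U w * V w)%:E = \int[P]_w (U w)%:E * \int[P]_w (V w)%:E)%E.
Proof.
move=> mU mV U0 V0 UV.
pose U' : {RV P >-> R} := HB.pack U (isMeasurableFun.Build _ _ _ _ _ mU).
pose V' : {RV P >-> R} := HB.pack V (isMeasurableFun.Build _ _ _ _ _ mV).
have mUV : measurable_fun setT (fun w => (U w, V w)).
  exact: measurable_fun_pair.
pose m' : {measure set (R * R)%type -> \bar R} :=
  pushforward P (fun w => (U w, V w)).
pose m1 := distribution P U'; pose m2 := distribution P V'.
(* Absolute values make the integrand nonnegative on the whole plane, as the change of variables and
   Tonelli require; they change nothing on the values of [U] and [V]. *)
pose f (z : R * R) : \bar R := (`|z.1| * `|z.2|)%:E.
have mf : measurable_fun setT f.
  apply/measurable_EFinP; apply: measurable_funM.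
    by apply: measurableT_comp => //; exact: measurable_fst.
  by apply: measurableT_comp => //; exact: measurable_snd.
have mn : measurable_fun setT (fun x : R => `|x|%:E : \bar R).
  by apply/measurable_EFinP; exact: normr_measurable.
have -> : (\int[P]_w (U w * V w)%:E = \int[m' mUV]_z f z)%E.
  rewrite ge0_integral_pushforward//.
    by apply: eq_integral => w _; rewrite /f/= !ger0_norm.
  by move=> z _; rewrite lee_fin mulr_ge0.
have -> : (\int[P]_w (U w)%:E = \int[m1]_x `|x|%:E)%E.
  rewrite ge0_integral_pushforward//.
  by apply: eq_integral => w _; rewrite /= ger0_norm.
have -> : (\int[P]_w (V w)%:E = \int[m2]_x `|x|%:E)%E.
  rewrite ge0_integral_pushforward//.
  by apply: eq_integral => w _; rewrite /= ger0_norm.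
rewrite (@eq_measure_integral _ _ _ _ (m1 \x m2)%E); last first.
  move=> A mA _; apply/esym.
  by apply: (@product_measure_unique _ _ _ _ _ m1 m2 (m' mUV)) => //; exact: UV.
rewrite fubini_tonelli1//=; last by move=> z; rewrite lee_fin mulr_ge0.
rewrite /fubini_F /f/=.
under eq_integral => x _.
  under eq_integral => y _ do rewrite EFinM.
  rewrite ge0_integralZl_EFin//.
  over.
rewrite ge0_integralZr//.
by apply: integral_ge0 => x _; rewrite lee_fin.
Qed.

(** The space is only pointed, so that the lemma serves both for random variables on [Om] and, in
    [cylinders_sum], for the coordinates of [nat -> R]. *)
Lemma past_measurable_sum (R : realType) (Om : pointedType)
    (X : nat -> Om -> R) (k : nat) :
  measurable_fun setT ((fun w => \sum_(j < k) X j w) :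
    g_sigma_algebraType (past X k) -> R).
Proof.
apply: measurable_sum => j _ B mB; rewrite setTI; apply: sub_sigma_algebra.
exists (fun l => if l == j :> nat then B else setT); split.
  by move=> l; case: ifP.
apply/seteqP; split => w /=; first by move=> h l _; case: eqP => // ->.
by move/(_ j (ltn_ord j)); rewrite eqxx.
Qed.

Lemma mgf_sum (d : measure_display) (Om : measurableType d)
    (R : realType) (P : probability Om R) (X : nat -> Om -> R) (k : nat)
    (lam : R) :
  (forall j, measurable_fun setT (X j)) ->
  (forall i j B, measurable B -> P (X i @^-1` B) = P (X j @^-1` B)) ->
  product_rule P X setT 1 ->
  (forall j, subgaussian1 P (X j)) ->
  (\int[P]_w (expR (lam * \sum_(j < k) X j w))%:E <=
   (expR (k%:R * (lam ^+ 2 / 2)))%:E)%E.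
Proof.
move=> mX idX PX sX.
elim: k => [|k IH].
  under eq_integral do rewrite big_ord0 mulr0 expR0.
  rewrite mul0r expR0 integral_cst//. by rewrite mul1e; exact: probability_le1.
have mE : measurable_fun setT (fun x : R => expR (lam * x)).
  by apply: measurableT_comp => //; exact: measurable_funM.
have mS : measurable_fun setT (fun w => \sum_(j < k) X j w).
  exact: measurable_sum.
have -> : (\int[P]_w (expR (lam * \sum_(j < k.+1) X j w))%:E =
  \int[P]_w (expR (lam * \sum_(j < k) X j w) * expR (lam * X k w))%:E)%E.
  by apply: eq_integral => w _; rewrite big_ord_recr/= mulrDr expRD.
rewrite expectation_mul_indep//.
- rewrite -natr1 mulrDl mul1r expRD EFinM lee_pmul//.
  + by apply: integral_ge0 => w _; rewrite lee_fin expR_ge0.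
  + by apply: integral_ge0 => w _; rewrite lee_fin expR_ge0.
  + by have := sX k lam; rewrite unlock.
- exact: (measurableT_comp mE mS).
- exact: (measurableT_comp mE (mX k)).
move=> A B mA mB.
have mA' : measurable ((fun x : R => expR (lam * x)) @^-1` A).
  by rewrite -[Y in measurable Y]setTI; exact: mE.
have mB' : measurable ((fun x : R => expR (lam * x)) @^-1` B).
  by rewrite -[Y in measurable Y]setTI; exact: mE.
pose F := (fun w => \sum_(j < k) X j w) @^-1` ((fun x => expR (lam * x)) @^-1` A).
(* Coordinate 0 of the sequence shifted by [k] is [X k], so independence of past and future
   separates the last increment from the partial sum. *)
pose D := [set x : nat -> R | B (expR (lam * x 0%N))].
have sF : <<s past X k >> F.
  have := @past_measurable_sum R Om X k measurableT _ mA'.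
  by rewrite setTI.
have sD : <<s @cylinders R >> D.
  apply: sub_sigma_algebra; exists 1%N, (fun=> (fun x => expR (lam * x)) @^-1` B).
  split => //; apply/seteqP; split => x /=; first by move=> h [|].
  by move/(_ 0%N isT).
have := past_future_indep mX idX PX sF sD.
rewrite [(fun w m => X (k + m)%N w) @^-1` D](_ : _ =
  X k @^-1` ((fun x => expR (lam * x)) @^-1` B)); last first.
  by rewrite /D /preimage/= addn0.
by move=> ->; congr (_ * _)%E; exact: (idX 0%N k _ mB').
Qed.

(** Chernoff's bound at parameter [c], which is optimal for the level [k c]: the exponent is
    [k c^2 / 2 - k c^2]. The sign [sg] covers both tails: the lower one for a good arm, the upper
    one for overshoots. *)
Lemma subgaussian_sum_tail (d : measure_display) (Om : measurableType d)
    (R : realType) (P : probability Om R) (X : nat -> Om -> R) (k : nat)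
    (sg c : R) :
  (forall j, measurable_fun setT (X j)) ->
  (forall i j B, measurable B -> P (X i @^-1` B) = P (X j @^-1` B)) ->
  product_rule P X setT 1 ->
  (forall j, subgaussian1 P (X j)) -> sg ^+ 2 = 1 -> 0 < c ->
  (P [set w | k%:R * c <= sg * \sum_(j < k) X j w]%R <=
   (expR (- (c ^+ 2 / 2)) ^+ k)%:E)%E.
Proof.
move=> mX idX PX sX sg1 c0.
have mS : measurable_fun setT (fun w => sg * \sum_(j < k) X j w).
  by apply: measurable_funM => //; exact: measurable_sum.
pose Y : {RV P >-> R} := HB.pack (fun w => sg * \sum_(j < k) X j w)
  (isMeasurableFun.Build _ _ _ _ _ mS).
apply: (le_trans (@chernoff _ _ _ P Y c (k%:R * c) c0)).
rewrite /mmt_gen_fun unlock.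
have := @mgf_sum _ _ _ P X k (c * sg) mX idX PX sX.
under eq_integral do rewrite -mulrA mulrC.
set I := (\int[P]_x _)%E => hI.
have h : (I * (expR (- (c * (k%:R * c))))%:E <=
  (expR (k%:R * ((c * sg) ^+ 2 / 2)))%:E * (expR (- (c * (k%:R * c))))%:E)%E.
  by rewrite lee_wpmul2r// lee_fin expR_ge0.
apply: (le_trans h); rewrite -EFinM lee_fin -expRD -expRM_natl.
by rewrite ler_expR exprMn sg1 mulr1 -mulr_natl; lra.
Qed.

Lemma cylinders_bigcap (R : realType) (F : nat -> set (nat -> R)) :
  (forall u, <<s @cylinders R >> (F u)) ->
  <<s @cylinders R >> (\bigcap_u F u).
Proof.
pose T' : pointedType := HB.pack (nat -> R) (gen_eqMixin (nat -> R))
  (gen_choiceMixin (nat -> R)) (isPointed.Build (nat -> R) (fun=> 0)).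
pose GT : measurableType _ :=
  g_sigma_algebraType (@cylinders R : set (set T')).
move=> cF; exact: (@bigcapT_measurable _ GT F cF).
Qed.

Lemma cylinders_sum (R : realType) (k : nat) (B : set R) : measurable B ->
  <<s @cylinders R >> [set x | B (\sum_(j < k) x j)].
Proof.
pose T' : pointedType := HB.pack (nat -> R) (gen_eqMixin (nat -> R))
  (gen_choiceMixin (nat -> R)) (isPointed.Build (nat -> R) (fun=> 0)).
move=> mB.
have := @past_measurable_sum R T' (fun j x => (x : nat -> R) j) k measurableT _ mB.
rewrite setTI; apply: sub_sigma_algebra2 => _ [B' [mB' ->]].
by exists k, B'.
Qed.

Definition above_line (R : realType) (dl : R) (m : nat) : set (nat -> R) :=
  [set x : nat -> R | forall u, (u <= m)%N -> - (u%:R * dl) <= \sum_(j < u) x j].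

Lemma cylinders_above_line (R : realType) (dl : R) m :
  <<s @cylinders R >> (above_line dl m).
Proof.
pose F u := [set x : nat -> R |
  (if (u <= m)%N then `[- (u%:R * dl), +oo[%classic else setT)
    (\sum_(j < u) x j)].
rewrite (_ : above_line _ _ = \bigcap_u F u).
  apply: cylinders_bigcap => u; apply: cylinders_sum.
  by case: ifP.
apply/seteqP; split => x /=.
  move=> h u _; rewrite /F/=; case: ifP => // um.
  by rewrite /= in_itv/= andbT; exact: h.
move=> h u um; have := h u I; rewrite /F/= um.
by rewrite /= in_itv/= andbT.
Qed.

(** If the drifted walk is minimal on [[0, M]] at time [k], then it is at most its initial value 0
    there, an event of the past, and the walk restarted at [k] stays above the line for [M - k]
    steps, an event of the future. The remaining length depends on [k], so [M] is taken large: early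
    [k] leave at least [T] steps, and late [k] have negligible weight [rho ^+ k]. *)
Lemma stays_above_line (d : measure_display) (Om : measurableType d)
    (R : realType) (P : probability Om R) (X : nat -> Om -> R) (dl : R)
    (T : nat) :
  (forall j, measurable_fun setT (X j)) ->
  (forall i j B, measurable B -> P (X i @^-1` B) = P (X j @^-1` B)) ->
  product_rule P X setT 1 ->
  (forall j, subgaussian1 P (X j)) -> 0 < dl ->
  1 - expR (- (dl ^+ 2 / 2)) <=
    fine (P ((fun w k => X k w) @^-1` above_line dl T)).
Proof.
move=> mX idX PX sX dl0.
pose z := dl ^+ 2 / 2; pose rho := expR (- z).
have z0 : 0 < z by rewrite /z divr_gt0 ?exprn_gt0.
have rho0 : 0 < rho by exact: expR_gt0.
have rho1 : rho < 1 by rewrite /rho expR_lt1 oppr_lt0.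
rewrite -/z -/rho.
pose p m := fine (P ((fun w k => X k w) @^-1` above_line dl m)).
have mE q m : measurable ((fun w k => X (q + k)%N w) @^-1` above_line dl m).
  apply: (@measurable_cylinder_preimage _ _ _ (fun m => X (q + m)%N)) => //.
  exact: cylinders_above_line.
have mE0 m : measurable ((fun w k => X k w) @^-1` above_line dl m).
  by have := mE 0%N m.
have p0 m : 0 <= p m by rewrite fine_ge0// measure_ge0.
have p1 m : p m <= 1.
  by rewrite -lee_fin fineK ?fin_num_measure// probability_le1.
have pmono m m' : (m <= m')%N -> p m' <= p m.
  move=> mm'; apply: fine_le; rewrite ?fin_num_measure//.
  by apply: le_measure; rewrite ?inE// => w h u um; apply: h; exact: leq_trans mm'.
pose F k := [set w | - 1 * \sum_(j < k) X j w \in `[k%:R * dl, +oo[].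
have sF k : <<s past X k >> (F k).
  have mB : measurable [set r : R | - 1 * r \in `[k%:R * dl, +oo[].
    have : measurable_fun setT (fun r : R => -1 * r) by exact: measurable_funM.
    by move=> /(_ measurableT `[k%:R * dl, +oo[%classic); rewrite setTI; apply.
  have := @past_measurable_sum R Om X k measurableT _ mB.
  by rewrite setTI.
have mF k : measurable (F k).
  have := sF k; apply: smallest_sub; first exact: sigma_algebra_measurable.
  by move=> A; exact: past_measurable.
have PF k : (P (F k) <= (rho ^+ k)%:E)%E.
  have := @subgaussian_sum_tail _ _ _ P X k (-1) dl mX idX PX sX.
  rewrite sqrrN expr1n => /(_ erefl dl0); apply: le_trans; apply: le_measure.
  - by rewrite inE.
  - rewrite inE; move: (mF k); congr measurable; apply/seteqP.
    by split => w; rewrite /F/= in_itv/= andbT.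
  - by move=> w; rewrite /F/= in_itv/= andbT.
(* [k] is the time at which the walk with drift [dl] is minimal on [0, M]. *)
have cover M : [set: Om] `<=`
    \big[setU/set0]_(k < M.+1) (F k `&`
      (fun w m => X (k + m)%N w) @^-1` above_line dl (M - k)).
  move=> w _.
  pose Y k := \sum_(j < k) X j w + k%:R * dl.
  have [k _ kmin] := @arg_minP _ _ 'I_M.+1 ord0 xpredT (fun k : 'I_M.+1 => Y k) isT.
  rewrite -(bigcup_mkord M.+1 (fun k => F k `&`
    (fun w m => X (k + m)%N w) @^-1` above_line dl (M - k))).
  exists k; first exact: ltn_ord.
  have Yk u : (u <= M)%N -> Y k <= Y u.
    by rewrite -ltnS => uM; exact: (kmin (Ordinal uM)).
  split.
    have := Yk 0%N isT; rewrite /F/= /Y big_ord0 mul0r addr0 in_itv/= andbT.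
    rewrite mulN1r. move: (\sum_(j < k) X j w) (k%:R * dl) => a b h. lra.
  move=> u uM; have : (k + u <= M)%N.
    by rewrite -leq_subRL// -ltnS.
  move=> /Yk; rewrite /Y big_split_ord/= natrD mulrDl.
  move: (\sum_(j < k) X j w) (k%:R * dl) (u%:R * dl) => a b e.
  by move: (\sum_(j < u) X (k + j)%N w) => f h; lra.
have bound M : 1 <= \sum_(0 <= k < M.+1) rho ^+ k * p (M - k)%N.
  rewrite -lee_fin -(@probability_setT _ _ _ P).
  pose A k := F k `&` (fun w m => X (k + m)%N w) @^-1` above_line dl (M - k).
  have mA k : measurable (A k) by exact: measurableI.
  apply: (@le_trans _ _ (P (\big[setU/set0]_(k < M.+1) A k))).
    apply: le_measure; [by rewrite inE| |exact: (cover M)].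
    by rewrite inE; exact: bigsetU_measurable.
  apply: (@le_trans _ _ (\sum_(k < M.+1) P (A k))%E).
    exact: Boole_inequality.
  rewrite big_mkord -sumEFin; apply: lee_sum => k _.
  rewrite past_future_indep//; last exact: cylinders_above_line.
  by rewrite EFinM lee_pmul// /p fineK ?fin_num_measure.
have geo n : (1 - rho) * \sum_(0 <= k < n) rho ^+ k <= 1.
  rewrite big_mkord -opprB mulNr -subrX1 opprB lerBlDr lerDl.
  by rewrite exprn_ge0// ltW.
apply/ler_addgt0Pr => e e0.
(* Since [rho ^+ N <= 1 / (1 + N z)], any [N > T / (e z)] makes [T rho ^+ N] at most [e]. *)
pose N := (Num.truncn (T%:R / (e * z))).+1.
have hN : T%:R * rho ^+ N <= e.
  have : T%:R / (e * z) < N%:R by exact: truncnS_gt.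
  rewrite ltr_pdivrMr ?mulr_gt0// => h1.
  have h2 : rho ^+ N * (1 + N%:R * z) <= 1.
    rewrite /rho -expRM_natl mulrN expRN mulrC ler_pdivrMr ?expR_gt0// mul1r.
    exact: expR_ge1Dx.
  have r0 : 0 < rho ^+ N by rewrite exprn_gt0.
  nra.
(* With [M = N + T], each [k <= N] leaves at least [T] steps, and exactly [T] values of [k] lie
   beyond [N]. *)
have := bound (N + T)%N.
rewrite (@big_cat_nat _ _ _ N.+1)//=; last by rewrite ltnS leq_addr.
set s1 := (X in 1 <= X + _); set s2 := (X in 1 <= _ + X) => h.
have h1 : s1 <= p T * \sum_(0 <= k < N.+1) rho ^+ k.
  rewrite /s1 mulr_sumr big_nat [leRHS]big_nat; apply: ler_sum => k /andP[_ kN].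
  rewrite mulrC; apply: ler_wpM2r; first by rewrite exprn_ge0// ltW.
  by apply: pmono; rewrite leq_subRL; [rewrite leq_add2r|lia].
have h2 : s2 <= T%:R * rho ^+ N.
  rewrite mulr_natl -[X in _ *+ X](addnK N T).
  rewrite (_ : T + N - N = (N + T).+1 - N.+1)%N; last by rewrite subSS addnC.
  rewrite -sumr_const_nat /s2 big_nat [leRHS]big_nat; apply: ler_sum => k /andP[Nk _].
  rewrite -[leRHS]mulr1; apply: ler_pM => //; first by rewrite exprn_ge0// ltW.
  by apply: ler_wiXn2l; [exact: ltW|exact: ltW|exact: ltnW].
have := geo N.+1; rewrite -/(p T).
have := p0 T.
move: h h1 h2 hN; move: s1 s2 (\sum_(0 <= k < N.+1) rho ^+ k) (T%:R * rho ^+ N).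
move=> s1 s2 G x; rewrite -/(p T); move: (p T) => q; nra.
Qed.

(** * Conditioning on the subsample *)

Lemma measure_finite_partition (d : measure_display) (Om : measurableType d)
    (R : realType) (P : probability Om R) (I : finType) (S : Om -> I)
    (F : set Om) :
  (forall A, measurable (S @^-1` [set A])) -> measurable F ->
  P F = (\sum_(A : I) P (S @^-1` [set A] `&` F))%E.
Proof.
move=> mS mF.
have mSF A : measurable (S @^-1` [set A] `&` F) by exact: measurableI.
suff H (l : seq I) : uniq l -> measurable [set w | S w \in l /\ F w] /\
    P [set w | S w \in l /\ F w] = (\sum_(A <- l) P (S @^-1` [set A] `&` F))%E.
  have [_ <-] := H _ (index_enum_uniq I); congr (P _).
  by apply/seteqP; split => w /=; [rewrite mem_index_enum|case].
elim: l => [_|A l IH /= /andP[Al ul]].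
  rewrite big_nil (_ : mkset _ = set0) ?measure0//.
  by apply/seteqP; split => w // [].
have [ml Pl] := IH ul.
have -> : [set w | S w \in A :: l /\ F w] =
    (S @^-1` [set A] `&` F) `|` [set w | S w \in l /\ F w].
  apply/seteqP; split => w /=.
    by rewrite inE => -[/predU1P[]]; [left|right].
  by rewrite inE => -[[-> ?]|[-> ?]]; rewrite ?eqxx ?orbT.
split; first exact: measurableU.
rewrite big_cons -Pl measureU//; apply/seteqP; split => w //=.
by move=> [[->] _ [Al' _]]; rewrite Al' in Al.
Qed.

(** The law is prescribed on sets of size [K] only, but their probabilities already add up to 1. *)
Lemma uniform_subset_other (d : measure_display) (Om : measurableType d)
    (R : realType) (P : probability Om R) (n K : nat) (S : Om -> {set 'I_n})
    (eps : 'I_n -> nat -> Om -> R) (A : {set 'I_n}) (F : set Om) :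
  (K <= n)%N -> uniform_subset_indep_noise P K S eps -> measurable F ->
  #|A| != K -> P (S @^-1` [set A] `&` F) = 0%E.
Proof.
move=> Kn [mS law] mF AK.
have PK (B : {set 'I_n}) : #|B| = K -> P (S @^-1` [set B]) = (('C(n, K)%:R)^-1)%:E.
  move=> BK; have := law B [::] (fun=> setT) BK isT (fun=> measurableT).
  rewrite big_nil mulr1 (_ : \bigcap_(j in _) _ = setT) ?setIT//.
  by apply/seteqP; split.
have C0 : 'C(n, K)%:R != 0 :> R by rewrite pnatr_eq0 -lt0n bin_gt0.
have := @measure_finite_partition _ _ _ P _ S setT mS measurableT.
rewrite probability_setT; under eq_bigr do rewrite setIT.
rewrite (bigID (fun B : {set 'I_n} => #|B| == K))/=.
rewrite [X in (X + _)%E](_ : _ = 1%E); last first.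
  under eq_bigr => B /eqP BK do rewrite PK//.
  rewrite sumEFin sumr_const.
  rewrite (_ : #|_| = 'C(n, K)); last first.
    rewrite -[in RHS](card_ord n) -cardsT -cards_draws -[LHS]cardsE.
    by apply: eq_card => B; rewrite !inE finset.subsetT.
  by congr EFin; rewrite -[LHS]mulr_natr mulVf.
set s := (\sum_(_ | _) _)%E => h.
have s0 : s = 0%E.
  have : s \is a fin_num.
    rewrite ge0_fin_numE ?sume_ge0//.
    by rewrite (@le_lt_trans _ _ 1%E) ?ltry// [leRHS]h leeDr.
  move: h; case: s => // x; rewrite -EFinD => -[h] _; congr EFin.
  lra.
have PA : P (S @^-1` [set A]) = 0%E.
  apply/eqP; rewrite eq_le measure_ge0 andbT -[leRHS]s0 /s (bigD1 A)//=.
  by rewrite leeDl// sume_ge0.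
apply/eqP; rewrite eq_le measure_ge0 andbT -PA; apply: le_measure.
- by rewrite inE; exact: measurableI.
- by rewrite inE.
- exact: subIsetl.
Qed.

Lemma product_rule_subset (d : measure_display) (Om : measurableType d)
    (R : realType) (P : probability Om R) (n K : nat) (S : Om -> {set 'I_n})
    (eps : 'I_n -> nat -> Om -> R) (A : {set 'I_n}) :
  uniform_subset_indep_noise P K S eps -> #|A| = K ->
  product_rule P (fun j : 'I_n * nat => eps j.1 j.2) (S @^-1` [set A])
    ('C(n, K)%:R)^-1.
Proof. by move=> [_ law] AK s B us mB; rewrite -(law A). Qed.

(** The hypothesis always couples the noise with an event [S = A]; summing over the [K]-subsets [A]
    recovers the unconditional independence. *)
Lemma product_rule_noise (d : measure_display) (Om : measurableType d)
    (R : realType) (P : probability Om R) (n K : nat) (S : Om -> {set 'I_n})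
    (eps : 'I_n -> nat -> Om -> R) :
  (K <= n)%N -> (forall i k, measurable_fun setT (eps i k)) ->
  uniform_subset_indep_noise P K S eps ->
  product_rule P (fun j : 'I_n * nat => eps j.1 j.2) setT 1.
Proof.
move=> Kn meps hS s B us mB; have [mS _] := hS.
have mF := @measurable_rect _ _ _ _ (fun j : 'I_n * nat => eps j.1 j.2) s B
  (fun j => meps j.1 j.2) mB.
rewrite setTI mul1r (@measure_finite_partition _ _ _ P _ S)//.
rewrite (bigID (fun A : {set 'I_n} => #|A| == K))/=.
rewrite [X in (_ + X)%E]big1 ?adde0 => [|A AK]; last first.
  exact: (uniform_subset_other Kn hS).
under eq_bigr => A /eqP AK do rewrite (product_rule_subset hS AK)//.
rewrite sumEFin sumr_const; congr EFin.
rewrite (_ : #|_| = 'C(n, K)); last first.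
  rewrite -[in RHS](card_ord n) -cardsT -cards_draws -[LHS]cardsE.
  by apply: eq_card => A; rewrite !inE finset.subsetT.
rewrite -[LHS]mulr_natl mulrA mulfV ?mul1r//.
by rewrite pnatr_eq0 -lt0n bin_gt0.
Qed.

(** Bundles a bound on the mean with the measurability and nonnegativity that additivity of the
    integral requires, so that bounds combine term by term. *)
Definition mean_le (d : measure_display) (Om : measurableType d)
    (R : realType) (P : probability Om R) (g : Om -> R) (v : R) :=
  [/\ measurable_fun setT g, (forall w, 0 <= g w) &
      (\int[P]_w (g w)%:E <= v%:E)%E].

Lemma mean_leD (d : measure_display) (Om : measurableType d)
    (R : realType) (P : probability Om R) (g h : Om -> R) (u v : R) :
  mean_le P g u -> mean_le P h v -> mean_le P (fun w => g w + h w) (u + v).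
Proof.
move=> [mg g0 gu] [mh h0 hv]; split.
- exact: measurable_funD.
- by move=> w; rewrite addr_ge0.
rewrite EFinD; under eq_integral do rewrite EFinD.
rewrite ge0_integralD//; first exact: leeD.
all: by [move=> ? _; rewrite lee_fin|apply/measurable_EFinP].
Qed.

Lemma mean_le_cst (d : measure_display) (Om : measurableType d)
    (R : realType) (P : probability Om R) (c : R) :
  0 <= c -> mean_le P (fun=> c) c.
Proof.
move=> c0; split => //.
rewrite integral_cst// -[leRHS]mule1 lee_wpmul2l ?lee_fin//.
exact: probability_le1.
Qed.

Lemma mean_leZ (d : measure_display) (Om : measurableType d)
    (R : realType) (P : probability Om R) (g : Om -> R) (c v : R) :
  0 <= c -> mean_le P g v -> mean_le P (fun w => c * g w) (c * v).
Proof.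
move=> c0 [mg g0 gu]; split.
- exact: measurable_funM.
- by move=> w; rewrite mulr_ge0.
rewrite EFinM; under eq_integral do rewrite EFinM.
rewrite ge0_integralZl_EFin//; first by rewrite lee_wpmul2l// lee_fin.
all: by [move=> ? _; rewrite lee_fin|apply/measurable_EFinP].
Qed.

Lemma mean_le_indic (d : measure_display) (Om : measurableType d)
    (R : realType) (P : probability Om R) (E : set Om) (v : R) :
  measurable E -> (P E <= v%:E)%E -> mean_le P (\1_E) v.
Proof.
move=> mE Ev; split => //.
by rewrite integral_indic// setIT.
Qed.

Lemma mean_le_sum (d : measure_display) (Om : measurableType d)
    (R : realType) (P : probability Om R) (I : Type) (s : seq I) (Q : pred I)
    (g : I -> Om -> R) (v : I -> R) :
  (forall i, Q i -> mean_le P (g i) (v i)) ->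
  mean_le P (fun w => \sum_(i <- s | Q i) g i w) (\sum_(i <- s | Q i) v i).
Proof.
move=> H; elim: s => [|i s IH].
  under eq_fun do rewrite big_nil.
  by rewrite big_nil; exact: mean_le_cst.
under eq_fun do rewrite big_cons.
rewrite big_cons; case: ifPn => // Qi.
by apply: mean_leD => //; exact: H.
Qed.

(* No measurability of [f] is needed: the integral of a nonnegative function is
   a supremum over the simple functions below it. *)
Lemma expectation_deficit_le (d : measure_display) (Om : measurableType d)
    (R : realType) (P : probability Om R) (f b : Om -> R) (c v : R) :
  (forall w, 0 <= f w) -> mean_le P b v -> 0 <= c ->
  (forall w, c <= f w + b w) -> (c%:E - 'E_P[f] <= v%:E)%E.
Proof.
move=> f0 [mb b0 bv] c0 cfb; rewrite unlock.
(* A measurable nonnegative minorant of [f], to which additivity of the integral applies. *)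
pose g w := Num.max 0 (c - b w).
have mg : measurable_fun setT g.
  by apply: measurable_maxr => //; exact: measurable_funB.
have g0 w : 0 <= g w by rewrite /g le_max lexx.
have gf : (\int[P]_w (g w)%:E <= \int[P]_w (f w)%:E)%E.
  rewrite !ge0_integralTE//; try by move=> w; rewrite lee_fin.
  apply: le_ereal_sup => _ [h hg <-]; exists h => // w.
  apply: (le_trans (hg w)); rewrite lee_fin /g ge_max f0/=.
  by rewrite lerBlDr.
have gb : (c%:E <= \int[P]_w (g w)%:E + \int[P]_w (b w)%:E)%E.
  rewrite -ge0_integralD//; last 4 first.
  - by move=> w _; rewrite lee_fin.
  - exact/measurable_EFinP.
  - by move=> w _; rewrite lee_fin.
  - exact/measurable_EFinP.
  rewrite -[leLHS]mule1 -(@probability_setT _ _ _ P) -integral_cst//.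
  apply: ge0_le_integral => //.
  - by apply/measurable_EFinP; exact: measurable_funD.
  - move=> w _; rewrite /cst -EFinD lee_fin -lerBlDr /g le_max.
    by rewrite lexx orbT.
have : (c%:E <= \int[P]_w (f w)%:E + v%:E)%E.
  by apply: (le_trans gb); exact: leeD.
case: (\int[P]_w (f w)%:E)%E => [x| |]//=.
  by rewrite -EFinD -EFinB !lee_fin => ?; lra.
by rewrite /= leNye.
Qed.

(** * Regret bounds *)

(** From [exp (- z) (1 + z) <= 1], each term satisfies [z rho^(t+1) <= rho^t - rho^(t+1)], and the
    sum telescopes. *)
Lemma sum_expR_tail_le (R : realType) (z : R) (T : nat) : 0 < z ->
  \sum_(1 <= u < T) expR (- z) ^+ u <= z^-1.
Proof.
move=> z0; set rho := expR (- z).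
have rho0 : 0 <= rho by exact: expR_ge0.
have rz : rho * (1 + z) <= 1.
  rewrite /rho expRN mulrC ler_pdivrMr ?expR_gt0// mul1r.
  exact: expR_ge1Dx.
suff H t : z * (\sum_(1 <= u < t.+1) rho ^+ u) <= 1 - rho ^+ t.
  rewrite -[leRHS]mulr1 -ler_pdivrMl ?invr_gt0// invrK.
  case: T => [|t]; first by rewrite big_geq// mulr0.
  by rewrite (le_trans (H t))// lerBlDr lerDl exprn_ge0.
elim: t => [|t IH]; first by rewrite big_geq// mulr0 expr0 subrr.
rewrite big_nat_recr//= mulrDr.
have h : rho ^+ t.+1 * (1 + z) <= rho ^+ t.
  by rewrite exprSr -mulrA ler_piMr// exprn_ge0.
by move: IH h; move: (\sum_(_ <= _ < _) _) (rho ^+ t) (rho ^+ t.+1) => a b c; lra.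
Qed.

Lemma product_rule_arm (d : measure_display) (Om : measurableType d)
    (R : realType) (P : probability Om R) (A : eqType)
    (X : A * nat -> Om -> R) (i : A) :
  product_rule P X setT 1 -> product_rule P (fun k => X (i, k)) setT 1.
Proof.
move=> PX s B us mB.
have us' : uniq [seq (i, k) | k <- s] by rewrite map_inj_uniq// => ? ? [->].
have := PX _ (fun j => B j.2) us' (fun j => mB j.2).
rewrite big_map => <-; congr (P (_ `&` _)).
apply/seteqP; split => w /= h.
  by move=> _ /mapP[k ks ->]; exact: h.
by move=> k ks; apply: (h (i, k)); apply/mapP; exists k.
Qed.

Lemma le_mu_star (R : realType) (n : nat) (mu : 'I_n -> R) i :
  mu i <= mu_star mu.
Proof. exact: le_bigmax. Qed.

Lemma mu_star_itv (R : realType) (n : nat) (mu : 'I_n -> R) :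
  (forall i, 0 <= mu i <= 1) -> 0 <= mu_star mu <= 1.
Proof.
move=> mu01; rewrite /mu_star bigmax_ge_id/=.
by apply/bigmax_leP; split => // i _; case/andP: (mu01 i).
Qed.

(** The summands account, in order, for samples without a good arm, for arms of gap at most [D], and
    for the overshoots of the other sampled arms. *)
Lemma greedy_regret_bound (R : realType) (d : measure_display)
    (Om : measurableType d) (P : probability Om R) (n : nat) (mu : 'I_n -> R)
    (T : nat) (eps : 'I_n -> nat -> Om -> R) (tb : {set 'I_n} -> 'I_n)
    (K : nat) (S : Om -> {set 'I_n}) (dl D : R) :
  (0 < n)%N -> (forall i, 0 <= mu i <= 1) ->
  (forall i k, measurable_fun setT (eps i k)) ->
  (forall i k, subgaussian1 P (eps i k)) ->
  (forall i k i' k' (B : set R), measurable B ->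
     P (eps i k @^-1` B) = P (eps i' k' @^-1` B)) ->
  tie_break tb -> (K <= n)%N -> uniform_subset_indep_noise P K S eps ->
  0 < dl -> 2 * dl <= D ->
  (regret P mu (subsampled_greedy_arm tb mu eps S) T <=
   (T%:R * expR (- ((1 - expR (- (dl ^+ 2 / 2))) *
      (K%:R * (num_best mu)%:R / n%:R) / 2)) +
    T%:R * D + K%:R * (1 + 8 / D))%:E)%E.
Proof.
move=> n0 mu01 meps seps ideps htb Kn hS dl0 dlD.
have D0 : 0 < D by apply: lt_le_trans dlD; rewrite mulr_gt0.
set ms := mu_star mu; set rho := expR (- (dl ^+ 2 / 2)).
have /andP[ms0 ms1] : 0 <= ms <= 1 by exact: mu_star_itv.
have rho0 : 0 <= rho by exact: expR_ge0.
have rho1 : rho <= 1.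
  by rewrite -[leRHS]expR0 ler_expR oppr_le0 divr_ge0// sqr_ge0.
pose X (j : 'I_n * nat) := eps j.1 j.2.
have mX j : measurable_fun setT (X j) by exact: meps.
have PX : product_rule P X setT 1 by exact: product_rule_noise hS.
have mS : forall A, measurable (S @^-1` [set A]) by case: hS.
pose C (A : {set 'I_n}) := S @^-1` [set A].
pose c : R := ('C(n, K)%:R)^-1.
have c0 : 0 <= c by rewrite invr_ge0.
have PXC (A : {set 'I_n}) : #|A| = K -> product_rule P X (C A) c.
  exact: product_rule_subset.
have Pi i : product_rule P (eps i) setT 1.
  exact: (@product_rule_arm _ _ _ P _ X i PX).
pose Best := [set i | mu i == ms]%SET.
(* No best arm of [A] is good. If [A] contains no best arm this always holds, in agreement with the
   bound [rho ^+ 0 = 1]. *)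
pose bad (A : {set 'I_n}) := [set w | forall i, i \in enum (A :&: Best)%SET ->
  (~` above_line dl T) (fun k => eps i k w)].
pose ev i u := [set w | (u%:R * (ms - mu i - dl) <= \sum_(k < u) eps i k w)%R].
have cylC (i : 'I_n) : <<s @cylinders R >> (~` above_line dl T).
  by rewrite -setTD; apply: sigma_algebraCD; exact: cylinders_above_line.
pose Ev i u := [set x : nat -> R | u%:R * (ms - mu i - dl) <= \sum_(k < u) x k].
have cEv i u : <<s @cylinders R >> (Ev i u).
  rewrite (_ : Ev i u = [set x | `[u%:R * (ms - mu i - dl), +oo[%classic
    (\sum_(k < u) x k)]); first exact: cylinders_sum.
  by apply/seteqP; split => x /=; rewrite in_itv/= andbT.
have numE : num_best mu = #|Best|.
  by apply: eq_card => i; apply/idP/idP; rewrite !inE.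
have blocks (A : {set 'I_n}) (L : seq 'I_n) (E : 'I_n -> set (nat -> R)) : uniq L ->
    #|A| = K -> (forall i, <<s @cylinders R >> (E i)) ->
    P (C A `&` [set w | forall i, i \in L -> E i (fun k => eps i k w)]) =
    (c * \prod_(i <- L) fine (P ((fun w k => eps i k w) @^-1` E i)))%:E.
  move=> uL AK cE.
  have := @independent_blocks _ _ _ P _ X (C A) c mX (mS A) c0 PX (PXC _ AK)
    L E [::] (fun=> setT) uL isT (fun=> fun F => False_ind _ (notF F)) cE
    (fun=> measurableT).
  rewrite big_nil mulr1 => <-; congr (P (_ `&` _)).
  by apply/seteqP; split => w; [split|case].
have mEv (E : 'I_n -> set (nat -> R)) i : <<s @cylinders R >> (E i) ->
    measurable ((fun w k => eps i k w) @^-1` E i).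
  exact: (@measurable_cylinder_preimage _ _ _ (eps i)).
have mbad A : measurable (bad A).
  apply: (@fin_bigcap_measurable _ _ _ [set i | i \in enum (A :&: Best)%SET]
    (fun i => (fun w k => eps i k w) @^-1` (~` above_line dl T))).
    exact: finite_finset.
  by move=> i _; apply: (mEv (fun=> ~` above_line dl T)); exact: cylC.
have mev i u : measurable (ev i u) by exact: (mEv (fun i => Ev i u)).
have PC (A : {set 'I_n}) : #|A| = K -> P (C A) = c%:E.
  move=> AK; have := PXC A AK [::] (fun=> setT) isT (fun=> measurableT).
  rewrite big_nil mulr1 => <-; congr (P _).
  by apply/seteqP; split => w; [split|case].
have Pbad (A : {set 'I_n}) : #|A| = K ->
    (P (C A `&` bad A) <= (c * rho ^+ #|(A :&: Best)%SET|)%:E)%E.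
  move=> AK; have -> := blocks A _ (fun=> ~` above_line dl T) (enum_uniq _) AK cylC.
  rewrite lee_fin ler_wpM2l// big_enum/= -prodr_const.
  apply: ler_prod => i _; apply/andP; split.
    by rewrite fine_ge0 ?measure_ge0.
  have mA := mEv (fun=> above_line dl T) i (cylinders_above_line dl T).
  rewrite (_ : _ @^-1` _ = ~` ((fun w k => eps i k w) @^-1` above_line dl T))//.
  rewrite probability_setC// fineB ?fin_num_measure//=.
  have := @stays_above_line _ _ _ P (eps i) dl T (meps i) (fun a b => ideps i a i b)
    (Pi i) (seps i) dl0.
  by rewrite -/rho; lra.
have Pev (A : {set 'I_n}) i u : #|A| = K -> D < ms - mu i ->
    (P (C A `&` ev i u) <=
     (c * expR (- ((ms - mu i - dl) ^+ 2 / 2)) ^+ u)%:E)%E.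
  move=> AK Di.
  have -> : P (C A `&` ev i u) = P (C A `&`
      [set w | forall j, j \in [:: i] -> Ev j u (fun k => eps j k w)]).
    congr (P (_ `&` _)); apply/seteqP; split => w /= h.
      by move=> j; rewrite inE => /eqP ->.
    by apply: h; rewrite inE.
  rewrite (blocks A [:: i] (fun j => Ev j u))// big_seq1 lee_fin ler_wpM2l//.
  have ci : 0 < ms - mu i - dl by lra.
  have := @subgaussian_sum_tail _ _ _ P (eps i) u 1 _ (meps i)
    (fun a b => ideps i a i b) (Pi i) (seps i) (expr1n _ _) ci.
  under [X in P X]eq_set do rewrite mul1r.
  rewrite -lee_fin fineK//; apply: fin_num_measure.
  exact: (mEv (fun j => Ev j u)).
have mC A : measurable (C A) by exact: mS.
have mCI A F : measurable F -> measurable (C A `&` F).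
  exact: measurableI.
(* At each [w] only the term [A = S w] is nonzero; summing over all [A] turns a quantity depending
   on the random sample into a combination of indicators with deterministic coefficients. *)
pose b1 w : R := \sum_(A : {set 'I_n}) T%:R * \1_(C A `&` bad A) w.
pose b2 w := \sum_(A : {set 'I_n}) \sum_(i in A | D < ms - mu i)
  (ms - mu i) * (\1_(C A) w + \sum_(1 <= u < T) \1_(C A `&` ev i u) w).
pose cA (A : {set 'I_n}) := if #|A| == K then c else 0.
have PCF (A : {set 'I_n}) F v : measurable F ->
    (#|A| = K -> (P (C A `&` F) <= (c * v)%:E)%E) ->
    mean_le P (\1_(C A `&` F)) (cA A * v).
  move=> mF PF; apply: mean_le_indic; first exact: mCI.
  rewrite /cA; case: ifPn => [/eqP|AK]; first exact: PF.
  by rewrite mul0r (uniform_subset_other Kn hS).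
pose v1 (A : {set 'I_n}) := T%:R * (cA A * rho ^+ #|(A :&: Best)%SET|).
pose v2 (A : {set 'I_n}) := \sum_(i in A | D < ms - mu i)
  (ms - mu i) * (cA A * 1 + \sum_(1 <= u < T)
    cA A * expR (- ((ms - mu i - dl) ^+ 2 / 2)) ^+ u).
have mb1 : mean_le P b1 (\sum_A v1 A).
  by apply: mean_le_sum => A _; apply: mean_leZ => //; apply: PCF; last exact: Pbad.
have mb2 : mean_le P b2 (\sum_A v2 A).
  apply: mean_le_sum => A _; apply: mean_le_sum => i /andP[_ Di].
  apply: mean_leZ; first by rewrite subr_ge0 le_mu_star.
  apply: mean_leD.
    rewrite -[C A]setIT; apply: PCF => // AK.
    by rewrite setIT PC// mulr1.
  apply: mean_le_sum => u _; apply: PCF; first exact: mev.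
  by move=> AK; exact: Pev.
have TD0 : 0 <= T%:R * D by rewrite mulr_ge0// ltW.
have mb := mean_leD (mean_le_cst P TD0) (mean_leD mb1 mb2).
have pw w : T%:R * ms <=
    \sum_(t < T) mu (subsampled_greedy_arm tb mu eps S w t) +
    (T%:R * D + (b1 w + b2 w)).
  have [_ b10 _] := mb1; have [_ b20 _] := mb2.
  have f0 : 0 <= \sum_(t < T) mu (subsampled_greedy_arm tb mu eps S w t).
    by apply: sumr_ge0 => t _; case/andP: (mu01 (subsampled_greedy_arm tb mu eps S w t)).
  have [hb|] := pselect (bad (S w) w).
    have : T%:R <= b1 w.
      rewrite /b1 (bigD1 (S w))//= indicE mem_set// mulr1 lerDl.
      by apply: sumr_ge0 => A _; rewrite mulr_ge0.
    have : T%:R * ms <= T%:R by rewrite ler_piMr.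
    by have := b20 w; lra.
  move=> /existsNP[i0 /not_implyP[]]; rewrite mem_enum inE => /andP[i0S].
  rewrite inE => /eqP i0ms /contrapT hi0.
  have := @greedy_regret_pathwise R n tb mu ms (S w) (fun i k => eps i k w) T i0 dl D
    htb i0S i0ms (le_mu_star mu) (ltW D0) (fun u uT => hi0 u (ltnW uT)).
  move=> /le_trans; apply; rewrite lerD2l lerD2l -[leLHS]add0r lerD//.
  rewrite /b2 (bigD1 (S w))//= -[leLHS]addr0 lerD//; last first.
    apply: sumr_ge0 => A _; apply: sumr_ge0 => i _.
    by rewrite mulr_ge0 ?subr_ge0 ?le_mu_star// addr_ge0// sumr_ge0.
  apply: ler_sum => i _; rewrite ler_wpM2l ?subr_ge0 ?le_mu_star//.
  rewrite lerD//; first by rewrite indicE mem_set.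
  apply: ler_sum => u _; rewrite indicE ler_nat.
  by case: (boolP (_ <= _)%R) => // h; rewrite mem_set.
rewrite /regret.
apply: (@le_trans _ _ (T%:R * D + (\sum_A v1 A + \sum_A v2 A))%:E).
  apply: expectation_deficit_le mb _ pw.
    by move=> w; apply: sumr_ge0 => t _; case/andP: (mu01 (subsampled_greedy_arm tb mu eps S w t)).
  by rewrite mulr_ge0.
rewrite lee_fin [leRHS]addrAC [leRHS]addrC lerD2l; apply: lerD.
  rewrite /v1 -mulr_sumr ler_wpM2l// numE.
  (* A best arm is good with probability at least [p = 1 - rho], so [(1 - p) ^+ k] is the bound for
     [k] sampled best arms all failing. *)
  have p01 : 0 <= 1 - rho <= 1 by lra.
  have := expected_power_intersection Best n0 Kn p01; rewrite subKr.
  apply: le_trans; rewrite [leRHS]big_mkcond; apply: ler_sum => A _.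
  by rewrite /cA; case: ifP => _ //; rewrite mul0r.
have v20 (A : {set 'I_n}) : #|A| != K -> v2 A = 0.
  move=> AK; rewrite /v2 /cA (negbTE AK) big1// => i _.
  by rewrite mul0r add0r big1 ?mulr0// => u _; rewrite mul0r.
rewrite (bigID (fun A : {set 'I_n} => #|A| == K))/= [X in _ + X]big1 ?addr0//.
have vle (A : {set 'I_n}) : #|A| == K -> v2 A <= c * (K%:R * (1 + 8 / D)).
  move=> AK; rewrite /v2 /cA AK big_mkcondr/=; move/eqP: AK => AK.
  apply: (@le_trans _ _ (\sum_(i in A) c * (1 + 8 / D))); last first.
    by rewrite sumr_const AK -[leLHS]mulr_natl mulrCA lexx.
  apply: ler_sum => i _; case: ifPn => [Di|_]; last first.
    apply: mulr_ge0 => //; apply: addr_ge0 => //; apply: divr_ge0 => //.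
    exact: ltW.
  rewrite -mulr_sumr -mulrDr mulrCA ler_wpM2l//.
  set y := ms - mu i in Di *.
  have y0 : 0 < y by exact: lt_trans Di.
  have y1 : y <= 1 by case/andP: (mu01 i) => ? _; rewrite /y; lra.
  have z0 : 0 < (y - dl) ^+ 2 / 2 by rewrite divr_gt0// exprn_gt0//; lra.
  have := sum_expR_tail_le T z0; set s := \sum_(_ <= _ < _) _ => hs.
  (* As [dl <= D / 2 < y / 2], the margin [y - dl] is at least [y / 2], and
     [2 y / (y - dl)^2 <= 8 / y <= 8 / D]. *)
  have h2 : y * ((y - dl) ^+ 2 / 2)^-1 <= 8 / D.
    rewrite ler_pdivrMr// mulrAC ler_pdivlMr//.
    have h3 : y / 2 <= y - dl by lra.
    have h4 : (y / 2) ^+ 2 <= (y - dl) ^+ 2 by rewrite ler_sqr ?nnegrE; lra.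
    by nra.
  rewrite mulrDr mulr1 lerD//; apply: le_trans h2.
  by rewrite ler_wpM2l// ltW.
apply: (le_trans (ler_sum _ vle)).
rewrite sumr_const (_ : #|_| = 'C(n, K)); last first.
  rewrite -[in RHS](card_ord n) -cardsT -cards_draws -[LHS]cardsE.
  by apply: eq_card => A; rewrite !inE finset.subsetT.
rewrite -[leLHS]mulr_natl mulrA /c mulfV ?mul1r ?lexx//.
by rewrite pnatr_eq0 -lt0n bin_gt0.
Qed.

(** * Choice of the parameters *)

Lemma num_best_gt0 (R : realType) (n : nat) (mu : 'I_n -> R) :
  (0 < n)%N -> (forall i, 0 <= mu i) -> (0 < num_best mu)%N.
Proof.
case: n mu => // n mu _ mu0.
have [i _ imax] := @arg_maxP _ _ _ (@ord0 n) xpredT mu isT.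
(* The maximum defining [mu_star] starts from 0; as the means are nonnegative, it is attained by an
   arm. *)
apply/card_gt0P; exists i; rewrite inE; apply/eqP/le_anti; rewrite le_mu_star.
by apply/bigmax_leP; split => // j _; exact: imax.
Qed.

Lemma regret_le_horizon (R : realType) (d : measure_display)
    (Om : measurableType d) (P : probability Om R) (n : nat) (mu : 'I_n -> R)
    (arm : Om -> nat -> 'I_n) (T : nat) :
  (forall i, 0 <= mu i <= 1) -> (regret P mu arm T <= (T%:R)%:E)%E.
Proof.
move=> mu01; have /andP[ms0 ms1] := mu_star_itv mu01.
have f0 w : 0 <= \sum_(t < T) mu (arm w t).
  by apply: sumr_ge0 => t _; case/andP: (mu01 (arm w t)).
apply: (expectation_deficit_le f0 (mean_le_cst P (ler0n R T))).
  exact: mulr_ge0.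
by move=> w; have := f0 w; have := ler_piMr (ler0n R T) ms1; lra.
Qed.

(** For [z = dl^2 / 2 <= 1 / 2], [1 - exp (- z) >= z / (1 + z) >= dl^2 / 3]. This 3 and the 2 of the
    sampling exponent make the 6 in the condition on [K], under which the exponent is at least
    [ln T] and a missing good arm costs at most [T / T = 1]. *)
Lemma greedy_regret_tuned (R : realType) (d : measure_display)
    (Om : measurableType d) (P : probability Om R) (n : nat) (mu : 'I_n -> R)
    (T : nat) (eps : 'I_n -> nat -> Om -> R) (tb : {set 'I_n} -> 'I_n)
    (K : nat) (S : Om -> {set 'I_n}) (dl D G : R) :
  (0 < n)%N -> (forall i, 0 <= mu i <= 1) -> (0 < T)%N ->
  n%:R / (num_best mu)%:R <= G ->
  (forall i k, measurable_fun setT (eps i k)) ->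
  (forall i k, subgaussian1 P (eps i k)) ->
  (forall i k i' k' (B : set R), measurable B ->
     P (eps i k @^-1` B) = P (eps i' k' @^-1` B)) ->
  tie_break tb -> (K <= n)%N -> uniform_subset_indep_noise P K S eps ->
  0 < dl -> dl ^+ 2 <= 1 -> 2 * dl <= D ->
  6 * ln T%:R * G <= dl ^+ 2 * K%:R ->
  (regret P mu (subsampled_greedy_arm tb mu eps S) T <=
   (1 + T%:R * D + K%:R * (1 + 8 / D))%:E)%E.
Proof.
move=> n0 mu01 T0 nG meps seps ideps htb Kn hS dl0 dl1 dlD hK.
apply: (le_trans (greedy_regret_bound T n0 mu01 meps seps ideps htb Kn hS dl0 dlD)).
rewrite lee_fin lerD2r lerD2r.
have m0 : (0 < num_best mu)%N.
  by apply: num_best_gt0 => // i; case/andP: (mu01 i).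
set m : R := (num_best mu)%:R in nG *.
have mR : 0 < m by rewrite ltr0n.
have nR : 0 < n%:R :> R by rewrite ltr0n.
have TR : 0 < T%:R :> R by rewrite ltr0n.
set z := dl ^+ 2 / 2; set p := 1 - expR (- z).
have z0 : 0 < z by rewrite divr_gt0// exprn_gt0.
have p3 : dl ^+ 2 / 3 <= p.
  have e1 : expR (- z) <= (1 + z)^-1.
    by rewrite expRN lef_pV2 ?posrE ?expR_gt0 ?expR_ge1Dx//; lra.
  have : (1 + z)^-1 <= 1 - dl ^+ 2 / 3.
    rewrite -[leLHS]mul1r ler_pdivrMr; last by lra.
    by rewrite /z; move: dl1 (sqr_ge0 dl); move: (dl ^+ 2) => a; nra.
  by rewrite /p; lra.
have L0 : 0 <= ln T%:R :> R by rewrite ln_ge0// ler1n.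
have hL : ln T%:R <= p * (K%:R * m / n%:R) / 2.
  rewrite ler_pdivrMr// in nG.
  have a : 6 * ln T%:R * n%:R <= dl ^+ 2 * K%:R * m.
    apply: (@le_trans _ _ (6 * ln T%:R * (G * m))).
      by apply: ler_wpM2l => //; rewrite mulr_ge0.
    by rewrite mulrA ler_wpM2r// ltW.
  have b : dl ^+ 2 / 3 * (K%:R * m) <= p * (K%:R * m).
    by rewrite ler_wpM2r// mulr_ge0// ltW.
  by rewrite mulrA mulrAC ler_pdivlMr//; lra.
rewrite expRN ler_pdivrMr ?expR_gt0// mul1r.
by rewrite -[leLHS]lnK ?posrE// ler_expR.
Qed.

Lemma ln_ge1 (R : realType) (T : nat) : (2 < T)%N -> 1 <= ln T%:R :> R.
Proof.
move=> T2; have T0 : 0 < T%:R :> R by rewrite ltr0n (leq_trans _ T2).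
rewrite -[leLHS]expRK ler_ln ?posrE ?expR_gt0//.
apply: (@le_trans _ _ 3); last by rewrite ler_nat.
(* It suffices that [exp 1 <= 3], which follows from [exp (-1) >= (5 / 6)^6 >= 1 / 3]. *)
have h : 5 / 6 <= expR (- 6^-1) :> R.
  by apply: le_trans (expR_ge1Dx _); lra.
have -> : expR 1 = expR (6%:R * 6^-1) :> R by congr expR; field.
rewrite expRM_natl -[leLHS]invrK -exprVn -expRN.
have h1 : (5 / 6) ^+ 6 <= expR (- 6^-1) ^+ 6 :> R.
  by apply: lerXn2r h; rewrite nnegrE ?expR_ge0//; lra.
have h2 : 3^-1 <= expR (- 6^-1) ^+ 6 :> R.
  by apply: le_trans h1; rewrite !exprS expr0; lra.
by rewrite -[leRHS]invrK lef_pV2 ?posrE ?invr_gt0 ?exprn_gt0 ?expR_gt0.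
Qed.

(** Here [g = T^gamma], [s = sqrt T] and [r = sqrt 3]. In units of [g s L] the terms [T D],
    [8 K / D] and [K] cost at most [7 / 2], [7] and [3], which add up to less than 14. *)
Lemma regret_terms_case_i (R : realType) (t L g s K r : R) :
  1 <= L -> 3 <= g -> g <= s -> 0 < s -> s ^+ 2 = t -> 0 < r -> r ^+ 2 = 3 ->
  K <= 3 * (g ^+ 2 * L) -> 0 <= K ->
  1 + t * (2 * r * g * Num.sqrt L / s) +
    K * (1 + 8 / (2 * r * g * Num.sqrt L / s)) <= 14 * (g * s) * L + 2.
Proof.
move=> L1 g3 gs s0 <- r0 r3 hK K0; set q := Num.sqrt L.
have q0 : 0 < q by rewrite sqrtr_gt0; lra.
have qq : q ^+ 2 = L by rewrite sqr_sqrtr; lra.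
have q1 : 1 <= q by rewrite -(ler_pXn2r (n := 2))// ?nnegrE ?qq ?expr1n; lra.
have g0 : 0 < g by lra.
have r2 : r <= 7 / 4 by rewrite -(ler_pXn2r (n := 2))// ?nnegrE ?r3; lra.
have -> : s ^+ 2 * (2 * r * g * q / s) = 2 * r * (g * s * q).
  by field; rewrite gt_eqF.
have -> : 8 / (2 * r * g * q / s) = 4 * r / 3 * (s / (g * q)).
  by rewrite -r3; field; rewrite !gt_eqF.
have gs0 : 0 < g * s by rewrite mulr_gt0.
have h1 : 2 * r * (g * s * q) <= 7 / 2 * (g * s * L).
  apply: ler_pM; [lra|by rewrite !mulr_ge0// ltW|lra|].
  by rewrite ler_pM2l// -qq expr2 ler_peMr// ltW.
have h2 : K * (4 * r / 3 * (s / (g * q))) <= 7 * (g * s * L).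
  have e : 3 * (g ^+ 2 * L) * (4 * r / 3 * (s / (g * q))) = 4 * r * (g * s * q).
    by rewrite -qq; field; rewrite !gt_eqF.
  apply: (@le_trans _ _ (4 * r * (g * s * q))); last by lra.
  rewrite -e; apply: ler_wpM2r => //.
  by rewrite mulr_ge0 ?divr_ge0 ?mulr_ge0// ltW.
have h3 : K <= 3 * (g * s * L).
  apply: (le_trans hK); rewrite ler_pM2l// ler_wpM2r//; first lra.
  by rewrite expr2 ler_wpM2l// ltW.
by rewrite mulrDr mulr1; lra.
Qed.

(** The same count, with the fourth roots [w], [v], [y] of [T], [T^gamma] and [log T], which turn
    all exponents into integers. *)
Lemma regret_terms_case_ii (R : realType) (w v y K r : R) :
  1 <= y -> 0 < v -> v <= w -> 0 < r -> r ^+ 2 = 3 ->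
  K <= 3 * (w ^+ 2 * v ^+ 2 * y ^+ 2) -> 0 <= K ->
  1 + w ^+ 4 * (2 * (r * y * v / w)) + K * (1 + 8 / (2 * (r * y * v / w))) <=
  14 * (w ^+ 3 * v) * y ^+ 2 + 2.
Proof.
move=> y1 v0 vw r0 r3 hK K0.
have w0 : 0 < w by exact: lt_le_trans vw.
have y0 : 0 < y by lra.
have r2 : r <= 7 / 4 by rewrite -(ler_pXn2r (n := 2))// ?nnegrE ?r3; lra.
have -> : w ^+ 4 * (2 * (r * y * v / w)) = 2 * r * (w ^+ 3 * v * y).
  by field; rewrite gt_eqF.
have -> : 8 / (2 * (r * y * v / w)) = 4 * r / 3 * (w / (y * v)).
  by rewrite -r3; field; rewrite !gt_eqF.
have W0 : 0 < w ^+ 3 * v by rewrite mulr_gt0// exprn_gt0.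
have h1 : 2 * r * (w ^+ 3 * v * y) <= 7 / 2 * (w ^+ 3 * v * y ^+ 2).
  apply: ler_pM; [lra|by rewrite mulr_ge0// ltW|lra|].
  by rewrite ler_pM2l// expr2 ler_peMr// ltW.
have h2 : K * (4 * r / 3 * (w / (y * v))) <= 7 * (w ^+ 3 * v * y ^+ 2).
  have e : 3 * (w ^+ 2 * v ^+ 2 * y ^+ 2) * (4 * r / 3 * (w / (y * v))) =
      4 * r * (w ^+ 3 * v * y).
    by field; rewrite !gt_eqF.
  apply: (@le_trans _ _ (4 * r * (w ^+ 3 * v * y))); last by lra.
  rewrite -e; apply: ler_wpM2r => //.
  by rewrite mulr_ge0 ?divr_ge0 ?mulr_ge0// ltW.
have h3 : K <= 3 * (w ^+ 3 * v * y ^+ 2).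
  apply: (le_trans hK); rewrite ler_pM2l// ler_wpM2r//; first exact: sqr_ge0.
  have -> : w ^+ 2 * v ^+ 2 = w ^+ 2 * v * v by ring.
  have -> : w ^+ 3 * v = w ^+ 2 * v * w by ring.
  by rewrite ler_wpM2l// mulr_ge0 ?sqr_ge0// ltW.
by rewrite mulrDr mulr1; lra.
Qed.

Theorem theorem8 (R : realType) (d : measure_display) (Om : measurableType d)
  (P : probability Om R) (n : nat) (mu : 'I_n -> R) (T : nat) (gamma : R)
  (eps : 'I_n -> nat -> Om -> R) (tb : {set 'I_n} -> 'I_n) :
  (0 < n)%N ->
  (forall i, 0 <= mu i <= 1) ->
  (0 < T)%N ->
  0 <= gamma <= 1 ->
  n%:R / (num_best mu)%:R <= T%:R `^ gamma ->
  (forall i k, measurable_fun setT (eps i k)) ->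
  (forall i k, subgaussian1 P (eps i k)) ->
  (forall i k i' k' (B : set R), measurable B ->
     P (eps i k @^-1` B) = P (eps i' k' @^-1` B)) ->
  tie_break tb ->
  (* (i) *)
  (T%:R `^ (1 - 3 * gamma) <= ln T%:R ->
   forall (K : nat) (S : Om -> {set 'I_n}),
     K%:R - 1 < 2 * T%:R `^ (2 * gamma) * ln T%:R <= K%:R ->
     (K <= n)%N ->
     uniform_subset_indep_noise P K S eps ->
     (regret P mu (subsampled_greedy_arm tb mu eps S) T <=
      (14 * T%:R `^ (gamma + 2^-1) * ln T%:R + 2)%:E)%E)
  /\
  (* (ii) *)
  (~ (T%:R `^ (1 - 3 * gamma) <= ln T%:R) ->
   forall (K : nat) (S : Om -> {set 'I_n}),
     K%:R - 1 < 2 * Num.sqrt (T%:R `^ (1 + gamma) * ln T%:R) <= K%:R ->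
     (K <= n)%N ->
     uniform_subset_indep_noise P K S eps ->
     (regret P mu (subsampled_greedy_arm tb mu eps S) T <=
      (14 * T%:R `^ ((3 + gamma) / 4) * Num.sqrt (ln T%:R) + 2)%:E)%E).
Proof.
move=> n0 mu01 T0 /andP[gam0 gam1] nG meps seps ideps htb.
have horizon S : (regret P mu (subsampled_greedy_arm tb mu eps S) T <= (T%:R)%:E)%E.
  exact: regret_le_horizon.
have trivial_bound S (B : R) : T%:R <= B ->
    (regret P mu (subsampled_greedy_arm tb mu eps S) T <= B%:E)%E.
  by move=> TB; apply: le_trans (horizon S) _; rewrite lee_fin.
have L0 : 0 <= ln T%:R :> R by rewrite ln_ge0// ler1n.
(* For [T <= 2] the additive 2 suffices; beyond, [log T >= 1], so that [sqrt (log T) <= log T]. *)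
have [T2|T3] := leqP T 2.
  have T2R : T%:R <= 2 :> R by rewrite ler_nat.
  split=> _ K S _ _ _; apply: trivial_bound; apply: (le_trans T2R).
    by rewrite lerDr mulr_ge0// mulr_ge0// powR_ge0.
  by rewrite lerDr mulr_ge0// mulr_ge0// powR_ge0.
have L1 := ln_ge1 R T3.
have TR : 0 < T%:R :> R by rewrite ltr0n.
have powE x : T%:R `^ x = expR (x * ln T%:R) :> R by rewrite /powR gt_eqF.
have TE : T%:R = expR (ln T%:R) :> R by rewrite lnK// posrE.
move: nG; rewrite !powE; set L := ln T%:R in L0 L1 TE * => nG.
pose r : R := Num.sqrt 3.
have r0 : 0 < r by rewrite sqrtr_gt0.
have r3 : r ^+ 2 = 3 by rewrite sqr_sqrtr.
have tuned := fun K S dl D => @greedy_regret_tuned R d Om P n mu T eps tb K S dl D _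
  n0 mu01 T0 nG meps seps ideps htb.
split=> [hL|_] K S /andP[K1 K2] Kn hS.
  set g := expR (gamma * L) in nG tuned; pose s := expR (2^-1 * L).
  have g1 : 1 <= g by rewrite -[leLHS]expR0 ler_expR mulr_ge0.
  have s0 : 0 < s by exact: expR_gt0.
  have st : s ^+ 2 = T%:R by rewrite -expRM_natl TE; congr expR; field.
  have g2E : expR (2 * gamma * L) = g ^+ 2.
    by rewrite -expRM_natl; congr expR; ring.
  have gsE : expR ((gamma + 2^-1) * L) = g * s by rewrite -expRD -mulrDl.
  (* The condition of case (i), rewritten as [T <= T^(3 gamma) log T]. *)
  have tg : s ^+ 2 <= g ^+ 3 * L.
    rewrite st; move: hL; rewrite (_ : (1 - 3 * gamma) * L = L + - (3%:R * (gamma * L))).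
      rewrite expRD -TE expRN expRM_natl ler_pdivrMr ?exprn_gt0 ?expR_gt0//.
      by rewrite mulrC.
    by ring.
  rewrite gsE; rewrite g2E in K1 K2.
  (* If [g > s], then [T = s^2 <= g s] and the bound is trivial. *)
  have [gs|sg] := leP g s; last first.
    apply: trivial_bound; rewrite -st.
    have : s ^+ 2 <= g * s by rewrite expr2 ler_wpM2r// ltW.
    have gs0 : 0 <= g * s by rewrite mulr_ge0 ?expR_ge0.
    have := ler_wpM2l gs0 L1; lra.
  (* Below 3 the choice [dl^2 = 3 / g] would exceed 1; there [tg] gives [s <= 14 g L], and the bound
     is trivial again. *)
  have [g3|g3] := ltP g 3.
    apply: trivial_bound; rewrite -st.
    have h : s <= 14 * g * L.
      rewrite -(ler_pXn2r (n := 2))// ?nnegrE; [|lra|].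
        apply: (le_trans tg).
        have : 0 <= g ^+ 2 * L by rewrite mulr_ge0// sqr_ge0.
        have -> : g ^+ 3 * L = g ^+ 2 * L * g by ring.
        have -> : (14 * g * L) ^+ 2 = g ^+ 2 * L * (196 * L) by ring.
        by move=> ?; rewrite ler_wpM2l//; lra.
      by rewrite !mulr_ge0//; lra.
    have := ler_wpM2l (ltW s0) h; rewrite expr2; lra.
  have X1 : 1 <= g ^+ 2 * L.
    by have := ler_pM _ _ (exprn_ege1 2 g1) L1; rewrite mulr1; apply.
  (* [K] is the ceiling of [2 g^2 L], and rounding adds less than [1 <= g^2 L]. *)
  have K3 : K%:R <= 3 * (g ^+ 2 * L) by lra.
  have D0 : 0 < 2 * r * g * Num.sqrt L / s.
    by rewrite !mulr_gt0 ?invr_gt0 ?sqrtr_gt0//; lra.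
  have dlg : (r / Num.sqrt g) ^+ 2 = 3 / g.
    by rewrite expr_div_n r3 sqr_sqrtr//; lra.
  apply: (le_trans (tuned K S (r / Num.sqrt g) (2 * r * g * Num.sqrt L / s) Kn hS _ _ _ _)).
  - by rewrite divr_gt0// sqrtr_gt0; lra.
  - by rewrite dlg ler_pdivrMr; lra.
  (* After squaring, [2 dl <= D] reads [12 / g <= 12 g^2 L / s^2], which is [tg]. *)
  - rewrite -(ler_pXn2r (n := 2))// ?nnegrE; last 2 first.
    + by rewrite mulr_ge0// divr_ge0 ?sqrtr_ge0.
    + exact: ltW.
    rewrite exprMn dlg !expr_div_n !exprMn r3 sqr_sqrtr//.
    rewrite ler_pdivlMr ?exprn_gt0//.
    have -> : 2 ^+ 2 * (3 / g) * s ^+ 2 = 12 * s ^+ 2 / g.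
      by field; rewrite gt_eqF//; lra.
    rewrite ler_pdivrMr; last by lra.
    have -> : 2 ^+ 2 * 3 * g ^+ 2 * L * g = 12 * (g ^+ 3 * L) by ring.
    by rewrite ler_pM2l.
  - rewrite dlg [leRHS]mulrAC ler_pdivlMr; last lra.
    have -> : 6 * L * g * g = 3 * (2 * g ^+ 2 * L) by ring.
    by apply: ler_wpM2l.
  by rewrite lee_fin; apply: regret_terms_case_i.
pose w := expR (4^-1 * L); pose v := expR (gamma / 4 * L).
have w0 : 0 < w by exact: expR_gt0.
have v0 : 0 < v by exact: expR_gt0.
have wt : w ^+ 4 = T%:R by rewrite -expRM_natl TE; congr expR; field.
have vg : expR (gamma * L) = v ^+ 4 by rewrite -expRM_natl; congr expR; field.
have v1 : 1 <= v by rewrite -[leLHS]expR0 ler_expR mulr_ge0// divr_ge0.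
have vw : v <= w by rewrite ler_expR ler_wpM2r//; lra.
have wvE : expR ((3 + gamma) / 4 * L) = w ^+ 3 * v.
  by rewrite -expRM_natl -expRD; congr expR; field.
pose q := Num.sqrt L; pose y := Num.sqrt q.
have qq : q ^+ 2 = L by rewrite sqr_sqrtr.
have q1 : 1 <= q by rewrite -(ler_pXn2r (n := 2))// ?nnegrE ?qq ?expr1n// sqrtr_ge0.
have yq : y ^+ 2 = q by rewrite sqr_sqrtr//; lra.
have y1 : 1 <= y by rewrite -(ler_pXn2r (n := 2))// ?nnegrE ?yq ?expr1n// sqrtr_ge0.
have XE : Num.sqrt (expR ((1 + gamma) * L) * L) = w ^+ 2 * v ^+ 2 * y ^+ 2.
  have -> : expR ((1 + gamma) * L) * L = (w ^+ 2 * v ^+ 2 * y ^+ 2) ^+ 2.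
    have -> : expR ((1 + gamma) * L) = w ^+ 4 * v ^+ 4.
      by rewrite -!expRM_natl -expRD; congr expR; field.
    by rewrite -qq -yq; ring.
  rewrite sqrtr_sqr ger0_norm//.
  by apply: mulr_ge0; [apply: mulr_ge0|]; exact: sqr_ge0.
rewrite wvE -/q -yq; rewrite XE in K1 K2.
have X1 : 1 <= w ^+ 2 * v ^+ 2 * y ^+ 2.
  by rewrite -!exprMn exprn_ege1// mulr_ege1 ?mulr_ege1//; exact: le_trans vw.
have K3 : K%:R <= 3 * (w ^+ 2 * v ^+ 2 * y ^+ 2) by lra.
have yv0 : 0 < y * v by rewrite mulr_gt0//; lra.
have dl2 : (r * y * v / w) ^+ 2 = 3 * (y * v) ^+ 2 / w ^+ 2.
  by rewrite expr_div_n -mulrA exprMn r3.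
have dl0 : 0 < r * y * v / w by rewrite divr_gt0// -mulrA mulr_gt0.
(* This [dl] solves [dl^2 K = 6 L v^4] at the unrounded [K = 2 w^2 v^2 y^2], where [L = y^4]. *)
have [dl1|dl1] := leP ((r * y * v / w) ^+ 2) 1.
  apply: (le_trans (tuned K S (r * y * v / w) (2 * (r * y * v / w)) Kn hS _ _ _ _)) => //.
    rewrite dl2 vg [leRHS]mulrAC ler_pdivlMr ?exprn_gt0//.
    have := ler_wpM2l (ltW (exprn_gt0 2 yv0)) K2.
    have -> : 6 * L * v ^+ 4 * w ^+ 2 =
      3 * ((y * v) ^+ 2 * (2 * (w ^+ 2 * v ^+ 2 * y ^+ 2))).
      by rewrite -qq -yq; ring.
    by move=> h; rewrite -[leRHS]mulrA; apply: ler_wpM2l.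
  by rewrite lee_fin -wt; apply: regret_terms_case_ii.
(* Here [dl > 1] means [w^2 < 3 (y v)^2], so [w <= 2 y v <= 14 v y^2], and multiplying by [w^3]
   shows that the bound exceeds [T]. *)
apply: trivial_bound; rewrite -wt.
have h : w <= 14 * v * y ^+ 2.
  move: dl1; rewrite dl2 ltr_pdivlMr ?exprn_gt0// mul1r => h.
  have h1 : w <= 2 * (y * v).
    rewrite -(ler_pXn2r (n := 2))// ?nnegrE; [|lra|lra].
    by rewrite exprMn; have := sqr_ge0 (y * v); lra.
  have h2 : y * v <= v * y ^+ 2 by rewrite mulrC expr2 mulrA ler_peMr// mulr_ge0//; lra.
  by lra.
have w30 : 0 <= w ^+ 3 by rewrite exprn_ge0// ltW.
have := ler_wpM2l w30 h.
by rewrite -exprSr; lra.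
Qed.
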